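(* Let $C=C_{\{\mathcal{I}_n,\mathcal{J}_n\}}$ be a nice Cantor set arising from a Cantor construction $\{\mathcal{I}_n,\mathcal{J}_n\}_n$. Then for each $0<p<\infty$ there exist a doubling measure $\mu$ on $\mathbb{R}$ and constants $0<\lambda\le\Lambda<\infty$ such that \[\lambda\left(\frac{|J_{n,i}|}{|I_{n,i}|}\right)^p\le\frac{\mu(J_{n,i})}{\mu(I_{n,i})}\le\Lambda\left(\frac{|J_{n,i}|}{|I_{n,i}|}\right)^p\] for every $n$ and every $I_{n,i}\in\mathcal{I}_n$.
   Context: A measure means a Borel regular outer measure. A measure $\mu$ on a metric space $X$ is doubling if there is $c<\infty$ with $0<\mu(B(x,2r))\le c\,\mu(B(x,r))<\infty$ for all $x\in X$, $r>0$ ($B(x,r)$ the open ball). A Cantor construction $\{\mathcal{I}_n,\mathcal{J}_n\}_n$: for each $n\in\mathbb{N}$, $\mathcal{I}_n=\{I_{n,i}\}_i$ is a collection of closed intervals with mutually disjoint interiors and $\mathcal{J}_n=\{J_{n,i}\}_i$ is a collection of open intervals with $J_{n,i}\subset I_{n,i}$, such that each $I_{n+1,i}$ is contained in some $I_{n,j}$, $\bigcup\mathcal{I}_{n+1}=\bigcup\mathcal{I}_n\setminus\bigcup\mathcal{J}_n$, $\sup_j|I_{n,j}|\to0$ as $n\to\infty$, and $\bigcup\mathcal{I}_1$ is bounded. The Cantor set is $C=\bigcap_n\bigcup_i I_{n,i}$. The construction (and set) is nice if there is $0<c<1$ with $cI_{n,i}\cap J_{n,i}\neq\emptyset$ for all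 $n,i$, where $cI$ denotes the closed interval concentric with $I$ of length $c|I|$. *)

(* Defs.v *)
From HB Require Import structures.
From mathcomp Require Import all_boot all_order all_algebra.
From mathcomp Require Import all_classical all_reals all_analysis.
Set Implicit Arguments. Unset Strict Implicit. Unset Printing Implicit Defensive.
Import Order.TTheory GRing.Theory Num.Theory.
Import numFieldNormedType.Exports.
Local Open Scope classical_set_scope.
Local Open Scope ring_scope.

Definition borel_set (R : realType) (B : set R) : Prop := <<s open >> B.

Definition borel_regular_outer_measure (R : realType)
    (mu : {outer_measure set R -> \bar R}) : Prop :=
  (forall B : set R, borel_set B -> mu.-caratheodory B) /\
  (forall A : set R, exists B : set R,
      [/\ borel_set B, A `<=` B & mu B = mu A]).

Definition doubling (R : realType) (mu : {outer_measure set R -> \bar R}) : Prop :=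
  borel_regular_outer_measure mu /\
  exists c : R, forall (x r : R), 0 < r ->
    [/\ (0 < mu (ball x (2 * r)))%E,
        (mu (ball x (2 * r)) <= c%:E * mu (ball x r))%E &
        (mu (ball x r) < +oo)%E].

(* A Cantor construction {I_n, J_n}_n: generations indexed by n : nat,
   members of generation n indexed by the elements i of D n (a subset of
   an index type T).
     I_{n,i} = [set` `[a n i, b n i]]   (closed interval, a n i <= b n i)
     J_{n,i} = [set` `]c n i, d n i[]   (open interval)                       *)
Definition cantor_construction (R : realType) (T : Type) (D : nat -> set T)
    (a b c d : nat -> T -> R) : Prop :=
  (forall n i, D n i -> a n i <= b n i) /\
      (forall n i j, D n i -> D n j -> i <> j ->
          [set` `]a n i, b n i[] `&` [set` `]a n j, b n j[] = set0) /\
      (forall n i, D n i -> [set` `]c n i, d n i[] `<=` [set` `[a n i, b n i]]) /\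
      (forall n i, D n.+1 i -> exists2 j, D n j &
          [set` `[a n.+1 i, b n.+1 i]] `<=` [set` `[a n j, b n j]]) /\
      (forall n, \bigcup_(i in D n.+1) [set` `[a n.+1 i, b n.+1 i]] =
          (\bigcup_(i in D n) [set` `[a n i, b n i]]) `\`
          (\bigcup_(i in D n) [set` `]c n i, d n i[])) /\
      (forall e : R, 0 < e -> exists N : nat, forall n i,
          (N <= n)%N -> D n i -> b n i - a n i <= e) /\
      (exists M : R, forall i x, D 0%N i -> [set` `[a 0%N i, b 0%N i]] x -> `|x| <= M).

Definition concentric (R : realType) (k a b : R) : set R :=
  [set` `[(a + b) / 2 - k * (b - a) / 2, (a + b) / 2 + k * (b - a) / 2]].

Definition nice (R : realType) (T : Type) (D : nat -> set T)
    (a b c d : nat -> T -> R) : Prop :=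
  exists k : R, [/\ 0 < k, k < 1 &
    forall n i, D n i -> concentric k (a n i) (b n i) `&` [set` `]c n i, d n i[] !=set0].

(* Main.v *)
(** The measure is the Stieltjes measure of a quasisymmetric homeomorphism F.
    For an interval I with hole J pick z in J deep inside I, put rho = eta |I|
    with eta small, and let h_I be the homeomorphism supported in the window
    [z - rho, z + rho] which near z looks like x |-> x (|x| + |J|/rho)^(p-1)
    (rescaled); thus |h_I(J)| ~ (|J|/rho)^p rho when |J| <= rho.  F is a limit of
    the compositions f_0 o f_1 o ... o f_n, where f_n applies h_I on each I of
    generation n.

    An interval I' of a later generation that meets the window of I avoids J, so
    its deep point stays at distance at least kap |I'| from z.  Hence windows
    containing a given point have sizes decreasing geometrically at a rate that
    is as fast as we like (eta small).  Two consequences give quasisymmetry at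
    scale r with uniform constants: the windows of intervals shorter than A r
    move points by at most r / 4 in total; and once a window of an interval of
    length at least A r has been met, each later (larger) window acts on a set
    that is tiny compared with its distance to the centre, so that it is affine
    up to a factor exp(C t_i) with t_i decreasing geometrically.  The endpoints
    of I and J are fixed by all later generations, so the ratio mu(J)/mu(I) can be
    read off at a finite stage. *)
Require Import Defs.
From HB Require Import structures.
From mathcomp Require Import all_boot all_order all_algebra.
From mathcomp Require Import all_classical all_reals all_analysis.
From mathcomp Require Import measurable_realfun ring lra.
Import Order.TTheory GRing.Theory Num.Theory.
Import numFieldNormedType.Exports.
Local Open Scope classical_set_scope.
Local Open Scope ring_scope.

Set Implicit Arguments.
Unset Strict Implicit.

(** * The one-hole profile *)

Section Profile.
Context {R : realType}.
Implicit Types p q s t x y u v : R.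

(** Both comparisons are assumed because the sign of [q] decides which one is used: a negative power
    reverses the order. *)
Lemma powR_ratio q s t (K : R) : 0 < s -> 0 < t -> 1 <= K ->
  s <= K * t -> t <= K * s -> s `^ q <= K `^ `|q| * t `^ q.
Proof.
move=> s0 t0 K1 sK tK; have K0 : 0 < K by lra.
have [q0|q0] := leP 0 q.
  by rewrite ger0_norm// -powRM ?(ltW s0) ?(ltW K0) ?(ltW t0)// ge0_ler_powR//
    nnegrE ?mulr_ge0 ?ltW.
have [r0 qE] : 0 <= - q /\ `|q| = - q by rewrite oppr_ge0 ltr0_norm ?ltW.
rewrite qE -[in leLHS](opprK q) -[in X in _ * X](opprK q); move: (- q) r0 => r r0.
rewrite !powRN ler_pdivlMr ?powR_gt0// mulrC ler_pdivrMr ?powR_gt0//.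
by rewrite -powRM ?(ltW s0) ?(ltW K0)// ge0_ler_powR// nnegrE ?mulr_ge0 ?ltW.
Qed.

Variables (p j : R).
Hypotheses (p0 : 0 < p) (j01 : 0 < j <= 1).

(** A regularised [j + |x|], equal to 1 off the unit window. The square makes its derivative vanish
    at [|x| = 1], so [bump] joins the identity with slope 1. *)
Definition gap x := 1 - (1 - j) * Num.max (1 - `|x|) 0 ^+ 2.
Definition bump x := x * gap x `^ (p - 1).

Lemma gap_out x : 1 <= `|x| -> gap x = 1.
Proof.
by move=> x1; rewrite /gap max_r ?expr0n ?mulr0 ?subr0//; lra.
Qed.

Lemma gap_in x : `|x| <= 1 -> gap x = 1 - (1 - j) * (1 - `|x|) ^+ 2.
Proof. by move=> x1; rewrite /gap max_l//; lra. Qed.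

Lemma gap_norm x : gap `|x| = gap x.
Proof. by rewrite /gap normr_id. Qed.

Lemma gapN x : gap (- x) = gap x.
Proof. by rewrite /gap normrN. Qed.

(** Inside the unit window these say that [gap x] is [j + |x|] up to a factor 2. *)
Lemma gap_bounds x :
  [/\ j <= gap x, gap x <= 1, gap x <= j + 2 * `|x| &
      `|x| <= 1 -> `|x| <= gap x].
Proof.
have /andP[j0 j1] := j01.
have x0 := normr_ge0 x.
have [x1|/ltW x1] := leP 1 `|x|; first by rewrite gap_out//; split => //; lra.
rewrite gap_in//; set X := `|x| in x0 x1 *.
have h1 : 0 <= (1 - j) * (X * (2 - X)) by rewrite !mulr_ge0//; lra.
have h2 : 0 <= j * (1 - X) ^+ 2 + X * (1 - X).
  by rewrite addr_ge0 ?mulr_ge0 ?sqr_ge0//; lra.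
have h3 : 0 <= j * X + (1 - j) * X ^+ 2.
  by rewrite addr_ge0 ?mulr_ge0 ?sqr_ge0//; lra.
have h4 : 0 <= (1 - j) * (1 - X) ^+ 2 by rewrite mulr_ge0 ?sqr_ge0//; lra.
have h5 : 0 <= j * X by rewrite mulr_ge0//; lra.
by split; lra.
Qed.

Lemma gap_gt0 x : 0 < gap x.
Proof.
have /andP[j0 j1] := j01; by case: (gap_bounds x) => *; lra. Qed.

Lemma gap_le x y : `|x| <= `|y| -> gap x <= gap y.
Proof.
have /andP[j0 j1] := j01.
move=> xy; have x0 := normr_ge0 x.
have [y1|/ltW y1] := leP 1 `|y|.
  by rewrite (gap_out y1); case: (gap_bounds x).
rewrite !gap_in//; last lra.
by have : 0 <= (1 - j) * ((`|y| - `|x|) * (2 - `|x| - `|y|));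
  [rewrite !mulr_ge0//; lra | lra].
Qed.

(** As a function of [|x|], [gap] is concave with positive value [j] at 0, so [gap x / |x|]
    decreases. On the window the difference of the two sides factors explicitly. *)
Lemma gap_star x y : `|x| <= `|y| -> `|x| * gap y <= `|y| * gap x.
Proof.
have /andP[j0 j1] := j01.
move=> xy; have x0 := normr_ge0 x.
have [y1|/ltW y1] := leP 1 `|y|.
  rewrite (gap_out y1); have [x1|/ltW x1] := leP 1 `|x|.
    by rewrite (gap_out x1); lra.
  have [_ _ _ /(_ x1)] := gap_bounds x; have := gap_gt0 x.
  by move=> g0 xg; rewrite mulr1 (le_trans xg)// ler_peMl// ltW.
rewrite !gap_in//; last lra.
have : 0 <= (`|y| - `|x|) * (j + (1 - j) * (`|x| * `|y|)).
  by rewrite mulr_ge0 ?subr_ge0 ?addr_ge0 ?(ltW j0)// !mulr_ge0 ?subr_ge0.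
lra.
Qed.

Lemma gap_subhom x y (l : R) : 1 <= l -> `|x| <= l * `|y| -> gap x <= l * gap y.
Proof.
move=> l1 xy; have gy := gap_gt0 y; have gx := gap_gt0 x.
have [xy'|/ltW yx] := leP `|x| `|y|.
  by rewrite (le_trans (gap_le xy'))// ler_peMl// ltW.
have [y0|y0] := eqVneq `|y| 0.
  have x0 : `|x| = 0 by move: (normr_ge0 x) xy; rewrite y0 mulr0; lra.
  by rewrite -gap_norm -(gap_norm y) x0 y0 ler_peMl// ltW// gap_gt0.
have {}y0 : 0 < `|y| by rewrite lt_neqAle eq_sym y0 normr_ge0.
rewrite -(ler_pM2l y0) (le_trans (gap_star yx))//.
by rewrite [leRHS]mulrA [X in _ <= X * _]mulrC ler_pM2r.
Qed.

Lemma gap_lip x y : `|gap x - gap y| <= 2 * `| `|x| - `|y| |.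
Proof.
have /andP[j0 j1] := j01.
wlog xy : x y / `|x| <= `|y|.
  move=> W; have [/W//|/ltW/W] := leP `|x| `|y|.
  by rewrite distrC [X in _ * X]distrC.
rewrite distrC [X in _ * X]distrC ger0_norm ?subr_ge0 ?gap_le//.
rewrite ger0_norm ?subr_ge0//; have x0 := normr_ge0 x.
have [x1|/ltW x1] := leP 1 `|x|; first by rewrite !gap_out//; lra.
have [y1|/ltW y1] := leP 1 `|y|.
  rewrite (gap_out y1) (gap_in x1).
  have : (1 - j) * (1 - `|x|) ^+ 2 <= 1 * (1 - `|x|).
    by rewrite ler_pM ?sqr_ge0 ?subr_ge0//; [lra|nra].
  lra.
rewrite !gap_in//.
have : (1 - j) * ((`|y| - `|x|) * (2 - `|x| - `|y|)) <= 1 * ((`|y| - `|x|) * 2).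
  by rewrite ler_pM ?mulr_ge0 ?ler_wpM2l ?subr_ge0//; lra.
lra.
Qed.

Lemma bumpN x : bump (- x) = - bump x.
Proof. by rewrite /bump gapN mulNr. Qed.

Lemma bump_out x : 1 <= `|x| -> bump x = x.
Proof. by move=> x1; rewrite /bump gap_out// powR1 mulr1. Qed.

(* On the positive half-line, [slope] is the derivative of [bump] and [drift] is
   the logarithmic derivative [x * gap' x / gap x]. *)
Definition drift x := 2 * (1 - j) * x * Num.max (1 - x) 0 / gap x.
Definition slope x := gap x `^ (p - 1) * (1 + (p - 1) * drift x).

Let bump_in_MVT x y : 0 < x -> x < y -> y <= 1 ->
  exists t, [/\ x <= t, t <= y & bump y - bump x = slope t * (y - x)].
Proof.
have /andP[j0 j1] := j01.
move=> x0 xy y1.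
(* The polynomial [g] agrees with [gap] on [[0, 1]], which avoids differentiating the maximum and
   the absolute value, in particular at 1. *)
pose g t := 1 - (1 - j) * (1 - t) ^+ 2 : R.
pose f t := t * (g t) `^ (p - 1) : R.
have fE t : 0 <= t -> t <= 1 -> f t = bump t.
  by move=> t0 t1; rewrite /bump gap_in ger0_norm.
have gE t : 0 <= t -> t <= 1 -> g t = gap t.
  by move=> t0 t1; rewrite gap_in ger0_norm.
have gd t : is_derive t (1 : R) g (2 * (1 - j) * (1 - t)).
  rewrite /g; apply: is_derive_eq; rewrite /GRing.scale /=; ring.
have fd t : t \in `[x, y] -> is_derive t (1 : R) f (slope t).
  rewrite in_itv/= => /andP[xt ty].
  have t0 : 0 < t by lra.
  have t1 : t <= 1 by lra.
  have gt0 : 0 < g t by rewrite gE ?gap_gt0//; lra.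
  have pd := @is_derive1_powR R (p - 1) (g t) gt0.
  have cd : is_derive t (1 : R) ((fun x => x `^ (p - 1)) \o g)
      ((2 * (1 - j) * (1 - t)) * ((p - 1) * g t `^ (p - 1 - 1))).
    rewrite mulrC; exact: is_derive1_comp.
  have fE' : f = (fun t => t) * ((fun x => x `^ (p - 1)) \o g) by [].
  rewrite fE'; apply: is_derive_eq.
  rewrite /GRing.scale /= /slope /drift -gE// ?(ltW t0)//.
  rewrite max_l; last lra.
  rewrite powRB; last by apply/implyP => _; rewrite gt_eqF.
  rewrite powRr1; last exact: ltW.
  field; exact: lt0r_neq0.
have cf : {within `[x, y], continuous f}.
  by apply: derivable_within_continuous => t /fd [].
have fd' t : t \in `]x, y[ -> is_derive t (1 : R) f (slope t).
  by move=> /subset_itv_oo_cc; exact: fd.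
have [t + E] := MVT xy fd' cf; rewrite in_itv/= => /andP[xt ty].
by exists t; split; [lra|lra|rewrite -E !fE//; lra].
Qed.

(** The upper bound is [(1 - j) * (1 - x) ^+ 2 + 2 * (1 - j) * x * (1 - x) = (1 - j) * (1 - x ^+ 2)
    <= 1]. *)
Lemma drift_itv x : 0 < x -> 0 <= drift x <= 1.
Proof.
have /andP[j0 j1] := j01.
move=> x0; have g0 := gap_gt0 x.
have [x1|/ltW x1] := leP 1 x.
  by rewrite /drift max_r ?mulr0 ?mul0r ?lexx//; lra.
rewrite /drift max_l; last lra.
have n0 : 0 <= 2 * (1 - j) * x * (1 - x) by rewrite !mulr_ge0//; lra.
rewrite ler_pdivrMr// mul1r divr_ge0 ?(ltW g0)//= gap_in gtr0_norm//.
by nra.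
Qed.

Lemma slope_out x : 1 <= x -> slope x = 1.
Proof.
move=> x1; have xE : `|x| = x by rewrite ger0_norm//; lra.
rewrite /slope gap_out ?xE// powR1 mul1r /drift max_r; last lra.
by rewrite mulr0 mul0r mulr0 addr0.
Qed.

(** A mean value inequality; the interval is split at 1, beyond which [bump] is the identity. *)
Lemma bump_mean x y (lo hi : R) : 0 < x -> x <= y ->
  (forall t, x <= t -> t <= y -> lo <= slope t <= hi) ->
  lo * (y - x) <= bump y - bump x <= hi * (y - x).
Proof.
have H01 x' y' : 0 < x' -> x' <= y' -> y' <= 1 ->
    (forall t, x' <= t -> t <= y' -> lo <= slope t <= hi) ->
    lo * (y' - x') <= bump y' - bump x' <= hi * (y' - x').
  move=> x0; rewrite le_eqVlt => /predU1P[->|xy] y1 H.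
    by rewrite !subrr !mulr0 lexx.
  have [t [xt ty ->]] := bump_in_MVT x0 xy y1.
  by have /andP[] := H t xt ty; rewrite !ler_pM2r ?subr_gt0// => -> ->.
have H1 x' y' : 1 <= x' -> x' <= y' ->
    (forall t, x' <= t -> t <= y' -> lo <= slope t <= hi) ->
    lo * (y' - x') <= bump y' - bump x' <= hi * (y' - x').
  move=> x1 xy H; rewrite !bump_out ?ger0_norm//; try lra.
  have /andP[] := H x' (lexx _) xy; rewrite slope_out// => l h.
  by apply/andP; split; nra.
move=> x0 xy H; have [y1|/ltW y1] := leP y 1; first exact: H01.
have [x1|/ltW x1] := leP 1 x; first exact: H1.
have /andP[a1 a2] : lo * (1 - x) <= bump 1 - bump x <= hi * (1 - x).
  by apply: H01 => // t tx t1; apply: H => //; lra.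
have /andP[b1 b2] : lo * (y - 1) <= bump y - bump 1 <= hi * (y - 1).
  by apply: H1 => // t tx t1; apply: H => //; lra.
have -> : y - x = (y - 1) + (1 - x) by rewrite addrA subrK.
have -> : bump y - bump x = (bump y - bump 1) + (bump 1 - bump x) by rewrite addrA subrK.
by rewrite (mulrDr lo (y - 1)) (mulrDr hi (y - 1)); apply/andP; split; exact: lerD.
Qed.

End Profile.

(** * Increments, quasisymmetry and logarithmic slope of the profile *)

Section ProfileEstimates.
Context {R : realType}.
Implicit Types q s t x y u v : R.
Variables (p j : R).
Hypotheses (p0 : 0 < p) (j01 : 0 < j <= 1).

Definition pmin := Num.min 1 p.
Definition pmax := Num.max 1 p.

Lemma pminmax : [/\ 0 < pmin, pmin <= 1, pmin <= p, 1 <= pmax & p <= pmax].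
Proof.
have p0' := p0; rewrite /pmin /pmax.
by have [p1|p1] := leP 1 p; split => //; lra.
Qed.

Definition weight x := gap j x `^ (p - 1).

Let weight_gt0 x : 0 < weight x.
Proof. by rewrite powR_gt0// gap_gt0. Qed.

Let weight_le x y : 1 <= p -> `|x| <= `|y| -> weight x <= weight y.
Proof.
move=> p1 xy; rewrite ge0_ler_powR ?subr_ge0//; last exact: gap_le.
- by rewrite nnegrE ltW// gap_gt0.
- by rewrite nnegrE ltW// gap_gt0.
Qed.

Let weight_ge x y : p <= 1 -> `|x| <= `|y| -> weight y <= weight x.
Proof.
move=> p1 xy; have gx := gap_gt0 j01 x; have gy := gap_gt0 j01 y.
have wE t : weight t = (gap j t `^ (1 - p))^-1 by rewrite -powRN opprB.
rewrite !wE lef_pV2 ?posrE ?powR_gt0//.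
rewrite ge0_ler_powR ?subr_ge0 ?nnegrE ?(ltW gx) ?(ltW gy)//.
exact: gap_le.
Qed.

(** Since [drift] lies in [[0, 1]], the factor [1 + (p - 1) * drift] lies between 1 and [p]. *)
Lemma slope_bounds x : 0 < x ->
  pmin * gap j x `^ (p - 1) <= slope p j x <= pmax * gap j x `^ (p - 1).
Proof.
move=> x0; rewrite /slope -/(weight x) ![_ * weight x]mulrC.
have /andP[e0 e1] := drift_itv j01 x0; rewrite !ler_pM2l ?weight_gt0//.
have p0' := p0; rewrite /pmin /pmax.
by have [p1|p1] := leP 1 p; apply/andP; split; nra.
Qed.

(** Four cases, by the sign of [x] and of [p - 1]. For [x <= 0] the increment is the sum
    [y * weight y + (- x) * weight x], and [y] is at least half of [y - x]. For [x > 0] one bound is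
    the monotonicity of the weight and the other the mean value inequality. *)
Let bump_incr_pos x y : - y <= x -> x < y ->
  pmin / 2 * (y - x) * weight y <= bump p j y - bump p j x <= 2 * pmax * (y - x) * weight y.
Proof.
move=> yx xy; have [m0 m1 mp P1 pP] := pminmax.
have c1 : pmin / 2 <= 1 / 2 by lra.
have c2 : pmin / 2 <= 1 by lra.
have c3 : pmin / 2 <= pmin by lra.
have c4 : 1 <= 2 * pmax by lra.
have c5 : 2 <= 2 * pmax by lra.
have c6 : pmax <= 2 * pmax by lra.
have P0 : 0 <= pmax by lra.
have y0 : 0 < y by lra.
have yx0 : 0 <= y + x by lra.
have wy := weight_gt0 y; have wx := weight_gt0 x.
have d0 : 0 < (y - x) * weight y by rewrite mulr_gt0// subr_gt0.
have xle : `|x| <= `|y| by rewrite (gtr0_norm y0) ler_norml yx ltW.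
have yE : `|y| = y by rewrite gtr0_norm.
have bE t : bump p j t = t * weight t by [].
have [x0|x0] := leP x 0.
  have xE : `|x| = - x by rewrite ler0_norm.
  have [p1|/ltW p1] := leP 1 p.
    have := weight_le p1 xle; rewrite !bE => ww.
    have w1 : 0 <= (- x) * (weight y - weight x).
      by rewrite mulr_ge0 ?subr_ge0// oppr_ge0.
    have w2 : 0 <= (- x) * weight x by rewrite mulr_ge0 ?oppr_ge0 ?(ltW wx) ?(ltW wy).
    have w3 : 0 <= (y + x) * weight y by rewrite mulr_ge0 ?(ltW wy).
    have E1 : pmin / 2 * (y - x) * weight y <= 1 / 2 * ((y - x) * weight y).
      by rewrite -mulrA ler_wpM2r ?(ltW d0)//.
    have E2 : 1 * ((y - x) * weight y) <= 2 * pmax * (y - x) * weight y.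
      by rewrite -[leRHS]mulrA ler_wpM2r ?(ltW d0)//.
    apply/andP; split.
      apply: (le_trans E1); rewrite -subr_ge0.
      rewrite (_ : _ - _ = (y + x) * weight y / 2 + (- x) * weight x); last by field.
      by rewrite addr_ge0// divr_ge0.
    apply: le_trans E2; rewrite mul1r -subr_ge0.
    by rewrite (_ : _ - _ = (- x) * (weight y - weight x)); last ring.
  have ww := weight_ge p1 xle; rewrite !bE.
  have w1 : 0 <= (- x) * (weight x - weight y).
    by rewrite mulr_ge0 ?subr_ge0// oppr_ge0.
  have E1 : pmin / 2 * (y - x) * weight y <= 1 * ((y - x) * weight y).
    by rewrite -mulrA ler_wpM2r ?(ltW d0)//.
  have E2 : 2 * ((y - x) * weight y) <= 2 * pmax * (y - x) * weight y.
    by rewrite -[leRHS]mulrA ler_wpM2r ?(ltW d0)//.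
  (* For [p <= 1] the weight near 0 may be large, so the bound comes from the monotonicity of [bump]
     between [- x] and [y], with 0 as lower slope. *)
  have w3 : (- x) * weight x <= y * weight y.
    have [->|xn0] := eqVneq x 0; first by rewrite oppr0 mul0r mulr_ge0 ?(ltW wy) ?(ltW y0).
    have nx0 : 0 < - x by rewrite oppr_gt0 lt_neqAle xn0.
    have /andP[+ _] : 0 * (y - - x) <= bump p j y - bump p j (- x) <=
        pmax * weight (- x) * (y - - x).
      apply: bump_mean => //; first lra.
      move=> t xt ty; have t0 : 0 < t by lra.
      have /andP[s1 s2] := slope_bounds t0.
      apply/andP; split; first by apply: le_trans s1; rewrite mulr_ge0 ?powR_ge0 ?(ltW m0).
      apply: (le_trans s2); rewrite ler_wpM2l//.
      by apply: weight_ge => //; rewrite !gtr0_norm.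
    by rewrite mul0r subr_ge0 !bE /weight gapN.
  have w4 : 0 <= (- x) * weight y by rewrite mulr_ge0 ?oppr_ge0 ?(ltW wx) ?(ltW wy).
  apply/andP; split.
    apply: (le_trans E1); rewrite mul1r -subr_ge0.
    by rewrite (_ : _ - _ = (- x) * (weight x - weight y)); last ring.
  apply: le_trans E2; rewrite -subr_ge0.
  rewrite (_ : _ - _ = (y * weight y - (- x) * weight x) + 2 * ((- x) * weight y)).
    by rewrite addr_ge0 ?subr_ge0// mulr_ge0.
  by ring.
have xE : `|x| = x by rewrite gtr0_norm.
have [p1|/ltW p1] := leP 1 p.
  have ww := weight_le p1 xle.
  have /andP[_ u2] : 0 * (y - x) <= bump p j y - bump p j x <= pmax * weight y * (y - x).
    apply: bump_mean => //; first exact: ltW.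
    move=> t xt ty; have t0 : 0 < t by lra.
    have /andP[s1 s2] := slope_bounds t0.
    apply/andP; split; first by apply: le_trans s1; rewrite mulr_ge0 ?powR_ge0 ?(ltW m0).
    apply: (le_trans s2); rewrite ler_wpM2l//.
    by apply: weight_le => //; rewrite !gtr0_norm.
  have w1 : 0 <= x * (weight y - weight x) by rewrite mulr_ge0 ?subr_ge0 ?(ltW x0).
  have E1 : pmin / 2 * (y - x) * weight y <= 1 * ((y - x) * weight y).
    by rewrite -mulrA ler_wpM2r ?(ltW d0)//.
  have E2 : pmax * ((y - x) * weight y) <= 2 * pmax * (y - x) * weight y.
    by rewrite -[leRHS]mulrA ler_wpM2r ?(ltW d0)//.
  apply/andP; split; last by apply: le_trans E2; rewrite (mulrC (y - x)) mulrA.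
  apply: (le_trans E1); rewrite mul1r -subr_ge0 !bE.
  by rewrite (_ : _ - _ = x * (weight y - weight x)); last ring.
have ww := weight_ge p1 xle.
have /andP[u1 _] : pmin * weight y * (y - x) <= bump p j y - bump p j x <=
    pmax * weight x * (y - x).
  apply: bump_mean => //; first exact: ltW.
  move=> t xt ty; have t0 : 0 < t by lra.
  have /andP[s1 s2] := slope_bounds t0.
  apply/andP; split.
    apply: le_trans s1; rewrite ler_wpM2l ?(ltW m0)//.
    by apply: weight_ge => //; rewrite !gtr0_norm.
  apply: (le_trans s2); rewrite ler_wpM2l//.
  by apply: weight_ge => //; rewrite !gtr0_norm.
have w1 : 0 <= x * (weight x - weight y) by rewrite mulr_ge0 ?subr_ge0 ?(ltW x0).
have E1 : pmin / 2 * (y - x) * weight y <= pmin * ((y - x) * weight y).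
  by rewrite -mulrA ler_wpM2r ?(ltW d0)//.
have E2 : 1 * ((y - x) * weight y) <= 2 * pmax * (y - x) * weight y.
  by rewrite -[leRHS]mulrA ler_wpM2r ?(ltW d0)//.
apply/andP; split; first by apply: (le_trans E1); rewrite (mulrC (y - x)) mulrA.
apply: le_trans E2; rewrite mul1r -subr_ge0 !bE.
by rewrite (_ : _ - _ = x * (weight x - weight y)); last ring.
Qed.

(** Whatever the sign of [p - 1], the mean slope over an interval is the weight at its endpoint
    farthest from 0, up to a constant. Oddness of [bump] reduces the remaining case to the previous
    one. *)
Lemma bump_incr x y : x < y ->
  let w := gap j (Num.max `|x| `|y|) `^ (p - 1) in
  pmin / 2 * (y - x) * w <= bump p j y - bump p j x <= 2 * pmax * (y - x) * w.
Proof.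
move=> xy /=; have [yx|yx] := leP (- y) x.
  have y0 : 0 < y by lra.
  rewrite max_r; last by rewrite (gtr0_norm y0) ler_norml yx ltW.
  by rewrite gap_norm; exact: bump_incr_pos.
have x0 : x < 0 by lra.
rewrite max_l; last first.
  by rewrite (ltr0_norm x0) ler_norml opprK (ltW xy) lerNr ltW.
rewrite gap_norm -gapN.
have /andP[] : pmin / 2 * (- x - - y) * weight (- x) <= bump p j (- x) - bump p j (- y)
    <= 2 * pmax * (- x - - y) * weight (- x) by apply: bump_incr_pos; lra.
rewrite /weight !bumpN => h1 h2; apply/andP; split; lra.
Qed.

Lemma bump_lt x y : x < y -> bump p j x < bump p j y.
Proof.
move=> xy; have /andP[+ _] := bump_incr xy; rewrite -subr_gt0; apply: lt_le_trans.
have [m0 _ _ _ _] := pminmax.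
by rewrite !mulr_gt0 ?subr_gt0 ?invr_gt0// powR_gt0// gap_gt0.
Qed.

(** The quotient of the two constants of [bump_incr], times 3 for the ratio of the lengths, times
    the ratio of the weights. *)
Definition qs_const := 4 * pmax / pmin * 3 * 7 `^ `|p - 1|.

Lemma bump_qs u y v : u < y -> y < v ->
  y - u <= 3 * (v - y) -> v - y <= 3 * (y - u) ->
  bump p j y - bump p j u <= qs_const * (bump p j v - bump p j y) /\
  bump p j v - bump p j y <= qs_const * (bump p j y - bump p j u).
Proof.
move=> uy yv uv vu; have [m0 m1 mp P1 pP] := pminmax.
have P0 : 0 <= 2 * pmax by rewrite mulr_ge0// (le_trans ler01).
have C0 : 0 <= qs_const.
  have P0' : 0 <= pmax by exact: le_trans P1.
  by rewrite /qs_const !mulr_ge0 ?powR_ge0 ?invr_ge0 ?(ltW m0).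
have /andP[l1 h1] := bump_incr uy; have /andP[l2 h2] := bump_incr yv.
move: l1 h1 l2 h2; set M1 := Num.max `|u| _; set M2 := Num.max `|y| _.
have n1 : 0 <= M1 by rewrite le_max normr_ge0.
have n2 : 0 <= M2 by rewrite le_max normr_ge0.
have uM : `|u| <= M1 by rewrite le_max lexx.
have yM : `|y| <= M1 by rewrite le_max lexx orbT.
have yM' : `|y| <= M2 by rewrite le_max lexx.
have vM : `|v| <= M2 by rewrite le_max lexx orbT.
move: (uM) (yM) (yM') (vM); rewrite !ler_norml => /andP[u1 u2] /andP[y1 y2]
  /andP[y3 y4] /andP[v3 v4].
(* The 7 comes from [|u| <= |y| + 3 * (v - y) <= |y| + 3 * (|v| + |y|) <= 7 * M2]. *)
have M12 : M1 <= 7 * M2.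
  rewrite ge_max ler_norml; apply/andP; split; last by rewrite ler_norml; lra.
  by apply/andP; split; lra.
have M21 : M2 <= 7 * M1.
  rewrite ge_max !ler_norml; apply/andP; split; first by apply/andP; split; lra.
  by apply/andP; split; lra.
have r12 : weight M1 <= 7 `^ `|p - 1| * weight M2.
  by apply: powR_ratio; rewrite ?(gap_gt0 j01) ?ler1n//;
    apply: (gap_subhom j01); rewrite ?ler1n// !ger0_norm.
have r21 : weight M2 <= 7 `^ `|p - 1| * weight M1.
  by apply: powR_ratio; rewrite ?(gap_gt0 j01) ?ler1n//;
    apply: (gap_subhom j01); rewrite ?ler1n// !ger0_norm.
rewrite -/(weight M1) -/(weight M2) => l1 h1 l2 h2.
set K := 7 `^ _ in r12 r21; have K0 : 0 < K by rewrite powR_gt0.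
have key s t wS wT : 0 < wS -> 0 < wT -> 0 < s -> 0 < t -> s <= 3 * t ->
    wS <= K * wT -> 2 * pmax * s * wS <= qs_const * (pmin / 2 * t * wT).
  move=> wS0 wT0 s0 t0 st w.
  have -> : qs_const * (pmin / 2 * t * wT) = 2 * pmax * ((3 * t) * (K * wT)).
    by rewrite /qs_const -/K; field; exact: lt0r_neq0.
  by rewrite -mulrA ler_wpM2l// ler_pM ?(ltW s0) ?(ltW wS0).
split.
  apply: (le_trans h1); apply: le_trans (ler_wpM2l C0 l2).
  by apply: key => //; rewrite subr_gt0.
apply: (le_trans h2); apply: le_trans (ler_wpM2l C0 l1).
by apply: key => //; rewrite subr_gt0.
Qed.

(** As [gap] is at most 1 and [p - 1 > -1], the weight is at most the inverse of [gap], and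
    [gap >= e] at the farther endpoint. *)
Lemma bump_growth x y (e : R) : x < y -> 0 < e -> e <= 1 ->
  e <= Num.max `|x| `|y| -> bump p j y - bump p j x <= 2 * pmax * (y - x) / e.
Proof.
move=> xy e0 e1; have [m0 m1 mp P1 pP] := pminmax.
have /andP[_] := bump_incr xy; set M := Num.max _ _ => h eM.
have M0 : 0 <= M by lra.
apply: (le_trans h); rewrite ler_wpM2l//; first by rewrite !mulr_ge0//; lra.
have g0 := gap_gt0 j01 M; have [_ g1 _ gM] := gap_bounds j01 M.
have eg : e <= gap j M.
  have [M1|/ltW M1] := leP 1 M; first by rewrite gap_out// ger0_norm.
  by move: gM; rewrite ger0_norm// => /(_ M1); lra.
apply: (@le_trans _ _ (gap j M)^-1); last by rewrite lef_pV2 ?posrE.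
rewrite -powR_inv1 ?(ltW g0)//; apply: (@ger_powR _ (gap j M)); first by rewrite g0.
by have := p0; lra.
Qed.

(** The first term controls the logarithm of the weight, the second that of
    [1 + (p - 1) * drift]. *)
Definition dist_const := 2 * `|p - 1| + 4 * `|p - 1| / pmin.

(** At distance at least [e] from the centre [gap] is at least [e]. Since [gap] is 2-Lipschitz, both
    factors of the slope have a logarithm that is Lipschitz with a constant of order [1 / e]. *)
Lemma slope_ratio x y (e : R) : 0 < e -> e <= x -> e <= y -> e <= 1 ->
  slope p j x <= expR (dist_const * (`|x - y| / e)) * slope p j y.
Proof.
move=> e0 ex ey e1; have [m0 m1 mp P1 pP] := pminmax.
have x0 : 0 < x by lra. have y0 : 0 < y by lra.
have gx := gap_gt0 j01 x; have gy := gap_gt0 j01 y.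
have /andP[dx0 dx1] := drift_itv j01 x0; have /andP[dy0 dy1] := drift_itv j01 y0.
have ge t : e <= t -> e <= gap j t.
  move=> et; have tE : `|t| = t by rewrite ger0_norm//; lra.
  have [t1|/ltW t1] := leP 1 t; first by rewrite gap_out ?tE.
  by have [_ _ _] := gap_bounds j01 t; rewrite tE => /(_ t1); lra.
set d := `|x - y|; have d0 : 0 <= d by exact: normr_ge0.
have := gap_lip j01 x y; rewrite (gtr0_norm x0) (gtr0_norm y0) -/d => gl.
have de0 : 0 <= d / e by rewrite divr_ge0// ltW.
have gxy : gap j x <= (1 + 2 * (d / e)) * gap j y.
  have : 2 * d <= 2 * (d / e) * gap j y.
    rewrite -mulrA ler_wpM2l// mulrAC ler_pdivlMr//.
    by rewrite ler_wpM2l// ge.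
  by move: (ler_normlW gl); lra.
have gyx : gap j y <= (1 + 2 * (d / e)) * gap j x.
  have : 2 * d <= 2 * (d / e) * gap j x.
    rewrite -mulrA ler_wpM2l// mulrAC ler_pdivlMr//.
    by rewrite ler_wpM2l// ge.
  by move: gl; rewrite distrC => /ler_normlW; lra.
have w : weight x <= expR (2 * (d / e) * `|p - 1|) * weight y.
  rewrite expRM; apply: powR_ratio => //.
  - by rewrite -expR0 ler_expR mulr_ge0.
  - by apply: (le_trans gxy); rewrite ler_wpM2r ?(ltW gy)// expR_ge1Dx.
  - by apply: (le_trans gyx); rewrite ler_wpM2r ?(ltW gx)// expR_ge1Dx.
set E : R -> R := fun t => 1 + (p - 1) * drift j t.
have Em t : 0 < t -> pmin <= E t.
  move=> t0; have /andP[t1 t2] := drift_itv j01 t0; rewrite /E /pmin.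
  by have p0' := p0; have [p1|p1] := leP 1 p; nra.
have dd : `|drift j x - drift j y| <= 4 * (d / e).
  pose n t : R := t * Num.max (1 - t) 0.
  have nlip s t : 0 < s -> 0 < t -> n s - n t <= `|s - t|.
    move=> s0 t0; rewrite /n; have := ler_norm (s - t); have := ler_norm (t - s).
    rewrite (distrC t s); set D := `|s - t| => D1 D2.
    have [s1|/ltW s1] := leP 1 s.
      rewrite (@max_r _ _ (1 - s)); last lra.
      by rewrite mulr0 sub0r lerNl (le_trans (_ : _ <= 0)) ?oppr_le0 ?normr_ge0//
        mulr_ge0 ?(ltW t0)// le_max lexx orbT.
    rewrite (@max_l _ _ (1 - s)); last lra.
    have [t1|/ltW t1] := leP 1 t; first by rewrite max_r; [nra|lra].
    rewrite max_l; last lra.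
    have -> : s * (1 - s) - t * (1 - t) = (s - t) * (1 - s - t) by ring.
    by have [st|/ltW st] := leP s t; nra.
  have nn : `|n x - n y| <= d.
    by rewrite ler_norml nlip// andbT lerNl opprB /d distrC nlip.
  (* A difference quotient rule. The 4 is 2 from the 1-Lipschitz numerator [n] plus 2 from [gap],
     using [drift <= 1]. *)
  have -> : drift j x - drift j y =
      (2 * (1 - j) * (n x - n y) + drift j y * (gap j y - gap j x)) / gap j x.
    by rewrite /drift /n; field; rewrite !lt0r_neq0.
  rewrite normrM normfV (gtr0_norm gx) ler_pdivrMr//.
  apply: (@le_trans _ _ (4 * d)); last first.
    by rewrite -mulrA ler_wpM2l// mulrAC ler_pdivlMr// ler_wpM2l// ge.
  have /andP[j0 j1] := j01.
  rewrite (le_trans (ler_normD _ _))// (normrM (2 * (1 - j))).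
  rewrite (normrM (drift j y)) (ger0_norm dy0).
  have -> : 4 * d = 2 * 1 * d + 1 * (2 * d) by ring.
  rewrite lerD// ler_pM ?normr_ge0//; last by rewrite distrC.
  by rewrite ger0_norm; lra.
have EE : E x <= expR (4 * (d / e) * `|p - 1| / pmin) * E y.
  apply: (@le_trans _ _ ((1 + 4 * (d / e) * `|p - 1| / pmin) * E y)); last first.
    by rewrite ler_wpM2r ?expR_ge1Dx// (le_trans (ltW m0))// Em.
  have : `|(p - 1) * (drift j x - drift j y)| <= `|p - 1| * (4 * (d / e)).
    by rewrite normrM ler_wpM2l.
  move=> /ler_normlW h.
  have : `|p - 1| * (4 * (d / e)) <= 4 * (d / e) * `|p - 1| / pmin * E y.
    have E1 : 1 <= pmin^-1 * E y by rewrite mulrC ler_pdivlMr// mul1r Em.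
    have A0 : 0 <= 4 * (d / e) * `|p - 1|.
      by rewrite mulr_ge0 ?normr_ge0// mulr_ge0.
    rewrite (mulrC `|p - 1|) -[leRHS]mulrA; exact: ler_peMr.
  by rewrite /E in h *; lra.
rewrite /dist_const /slope -/(weight x) -/(weight y) -/(E x) -/(E y).
have -> : (2 * `|p - 1| + 4 * `|p - 1| / pmin) * (d / e) =
   2 * (d / e) * `|p - 1| + 4 * (d / e) * `|p - 1| / pmin.
  by ring.
rewrite expRD mulrACA ler_pM// ?(ltW (weight_gt0 x))//.
by rewrite (le_trans (ltW m0))// Em.
Qed.

End ProfileEstimates.

(** * Near-affinity of the profile away from its centre, and its size on the hole *)

Section ProfileDistortion.
Context {R : realType}.
Implicit Types q s t x y u v : R.
Variables (p j : R).
Hypotheses (p0 : 0 < p) (j01 : 0 < j <= 1).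


Lemma bump_distort u v x1 y1 x2 y2 (e : R) : 0 < e -> e <= 1 ->
  e <= u \/ v <= - e -> u <= x1 -> x1 < y1 -> y1 <= v ->
  u <= x2 -> x2 < y2 -> y2 <= v ->
  (bump p j y1 - bump p j x1) * (y2 - x2) <=
    expR (dist_const p * ((v - u) / e)) * (bump p j y2 - bump p j x2) * (y1 - x1).
Proof.
move=> e0 e1.
have pos u' v' x1' y1' x2' y2' : e <= u' -> u' <= x1' -> x1' < y1' -> y1' <= v' ->
    u' <= x2' -> x2' < y2' -> y2' <= v' ->
  (bump p j y1' - bump p j x1') * (y2' - x2') <=
    expR (dist_const p * ((v' - u') / e)) * (bump p j y2' - bump p j x2') * (y1' - x1').
  move=> eu ux1 xy1 yv1 ux2 xy2 yv2; set K := expR _.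
  have K0 : 0 < K by exact: expR_gt0.
  have C0 : 0 <= dist_const p.
    have [m0 _ _ _ _] := pminmax p0.
    by rewrite /dist_const addr_ge0 ?mulr_ge0 ?invr_ge0 ?(ltW m0).
  have sK s t : u' <= s -> s <= v' -> u' <= t -> t <= v' -> slope p j s <= K * slope p j t.
    move=> us sv ut tv.
    have es : e <= s by lra.
    have et : e <= t by lra.
    have t0 : 0 < t by lra.
    apply: (le_trans (slope_ratio p0 j01 e0 es et e1)).
    rewrite ler_wpM2r//.
      have /andP[+ _] := slope_bounds p0 j01 t0; apply: le_trans.
      by rewrite mulr_ge0 ?powR_ge0//; case: (pminmax p0) => /ltW.
    rewrite ler_expR ler_wpM2l// ler_wpM2r ?invr_ge0 ?(ltW e0)//.
    by rewrite ler_norml; lra.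
  have x10 : 0 < x1' by lra.
  have x20 : 0 < x2' by lra.
  have d1 : 0 < y1' - x1' by lra.
  have d2 : 0 < y2' - x2' by lra.
  set S := (bump p j y1' - bump p j x1') / (y1' - x1').
  (* The slopes are averaged twice: over the first interval with [t] fixed, then over the second
     interval in [t]. *)
  have st t : x2' <= t -> t <= y2' -> S / K <= slope p j t.
    move=> xt ty.
    have ut : u' <= t by lra.
    have tv : t <= v' by lra.
    have /andP[_ h] : (slope p j t / K) * (y1' - x1') <= bump p j y1' - bump p j x1' <=
        K * slope p j t * (y1' - x1').
      apply: (bump_mean j01 x10 (ltW xy1)) => s xs sy.
      have us : u' <= s by lra.
      have sv : s <= v' by lra.
      by rewrite ler_pdivrMr// mulrC !sK.
    by rewrite ler_pdivrMr// mulrC ler_pdivrMr// mulrC.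
  have /andP[h _] : S / K * (y2' - x2') <= bump p j y2' - bump p j x2' <=
      K * slope p j x2' * (y2' - x2').
    apply: (bump_mean j01 x20 (ltW xy2)) => s xs sy.
    by rewrite st// sK//; lra.
  move: h; rewrite /S mulrAC ler_pdivrMr// mulrAC ler_pdivrMr//.
  by rewrite (mulrC K).
case=> [eu|ve] ux1 xy1 yv1 ux2 xy2 yv2; first exact: pos.
have : (bump p j (- x1) - bump p j (- y1)) * (- x2 - - y2) <=
    expR (dist_const p * ((- u - - v) / e)) * (bump p j (- x2) - bump p j (- y2)) *
    (- x1 - - y1) by apply: pos; lra.
rewrite !bumpN !opprK; congr (_ <= _); first by ring.
rewrite (_ : - u + v = v - u); last by ring.
by ring.
Qed.

(** On the hole [|x| <= j], so [gap] equals [j] up to a factor 3, and [bump] acts there like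
    multiplication by the power [p - 1] of [j]. *)
Lemma bump_core x0 x1 : x0 <= 0 -> 0 <= x1 -> x1 - x0 = j ->
  let K := 3 `^ `|p - 1| in
  j `^ p <= K * (bump p j x1 - bump p j x0) /\ bump p j x1 - bump p j x0 <= K * j `^ p.
Proof.
move=> x00 x10 xj /=; have /andP[j0 j1] := j01.
have gj x : `|x| <= j -> gap j x <= 3 * j /\ j <= 3 * gap j x.
  by move=> xj'; have [g1 _ g2 _] := gap_bounds j01 x; split; lra.
have n0 : `|x0| <= j by rewrite ler_norml; lra.
have n1 : `|x1| <= j by rewrite ler_norml; lra.
have [a0 b0] := gj _ n0; have [a1 b1] := gj _ n1.
have g0 := gap_gt0 j01 x0; have g1 := gap_gt0 j01 x1.
have h x := @powR_ratio R (p - 1) (gap j x) j 3 (gap_gt0 j01 x) j0.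
have h' x := @powR_ratio R (p - 1) j (gap j x) 3 j0 (gap_gt0 j01 x).
have i13 : (1 : R) <= 3 by rewrite ler1n.
have u0 := h x0 i13 a0 b0; have u1 := h x1 i13 a1 b1.
have l0 := h' x0 i13 b0 a0; have l1 := h' x1 i13 b1 a1.
have jE : j `^ p = x1 * j `^ (p - 1) + (- x0) * j `^ (p - 1).
  by rewrite -(mulr_powRB1 (ltW j0) p0) -mulrDl xj.
have bE : bump p j x1 - bump p j x0 = x1 * gap j x1 `^ (p - 1) + (- x0) * gap j x0 `^ (p - 1).
  by rewrite /bump; ring.
have nx0 : 0 <= - x0 by rewrite oppr_ge0.
rewrite jE bE !mulrDr !(mulrCA (3 `^ _)).
by split; apply: lerD; exact: ler_wpM2l.
Qed.

End ProfileDistortion.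

(** * The profile transported to a window of centre [z] and radius [r] *)

Section Bend.
Context {R : realType}.
Implicit Types x y u v : R.

Definition bend (p j z r : R) x := z + r * bump p j ((x - z) / r).

Variables (p j z r : R).
Hypotheses (p0 : 0 < p) (j01 : 0 < j <= 1) (r0 : 0 < r).
Local Notation f := (bend p j z r).
Let nrm x := (x - z) / r.

Let nrmB x y : nrm y - nrm x = (y - x) / r.
Proof. by rewrite /nrm -mulrBl; congr (_ / _); ring. Qed.

Let bendB x y : f y - f x = r * (bump p j (nrm y) - bump p j (nrm x)).
Proof. by rewrite /bend -/(nrm x) -/(nrm y); ring. Qed.

Let nrm_lt x y : x < y -> nrm x < nrm y.
Proof. by move=> xy; rewrite -subr_gt0 nrmB divr_gt0 ?subr_gt0. Qed.

Lemma bend_out x : r <= `|x - z| -> f x = x.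
Proof.
move=> h; rewrite /bend bump_out.
  by rewrite mulrC divfK ?lt0r_neq0// addrC subrK.
by rewrite normrM normfV (gtr0_norm r0) ler_pdivlMr// mul1r.
Qed.

Lemma bend_lt x y : x < y -> f x < f y.
Proof.
move=> xy; rewrite -subr_gt0 bendB mulr_gt0// subr_gt0 bump_lt//.
exact: nrm_lt.
Qed.

Lemma bend_le x y : x <= y -> f x <= f y.
Proof. by rewrite le_eqVlt => /predU1P[->//|/bend_lt/ltW]. Qed.

(** The map is increasing and fixes both ends of the window. *)
Lemma bend_ball x : `|x - z| <= r -> `|f x - z| <= r.
Proof.
have r0' := r0; rewrite !ler_norml => /andP[h1 h2].
have E1 : f (z - r) = z - r.
  by apply: bend_out; rewrite addrAC subrr sub0r normrN gtr0_norm.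
have E2 : f (z + r) = z + r.
  by apply: bend_out; rewrite addrAC subrr add0r gtr0_norm.
have lo : f (z - r) <= f x by apply: bend_le; lra.
have hi : f x <= f (z + r) by apply: bend_le; lra.
move: lo hi; rewrite E1 E2; clear E1 E2 h1 h2; move: (f x) => t lo hi.
by apply/andP; split; lra.
Qed.

Lemma bend_close x : `|f x - x| <= 2 * r.
Proof.
have r0' := r0.
have [h|/ltW h] := leP r `|x - z|.
  by rewrite bend_out// subrr normr0 mulr_ge0// ltW.
have := bend_ball h; move: h; rewrite !ler_norml; lra.
Qed.

Lemma bend_qs u y v : u < y -> y < v ->
  y - u <= 3 * (v - y) -> v - y <= 3 * (y - u) ->
  f y - f u <= qs_const p * (f v - f y) /\
  f v - f y <= qs_const p * (f y - f u).
Proof.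
move=> uy yv h1 h2; rewrite !bendB !(mulrCA _ r) !ler_pM2l//.
apply: bump_qs => //; try exact: nrm_lt.
- by rewrite !nrmB mulrA ler_pM2r ?invr_gt0.
- by rewrite !nrmB mulrA ler_pM2r ?invr_gt0.
Qed.

Lemma bend_distort u v x1 y1 x2 y2 (e : R) : 0 < e -> e <= r ->
  e <= u - z \/ v - z <= - e -> u <= x1 -> x1 < y1 -> y1 <= v ->
  u <= x2 -> x2 < y2 -> y2 <= v ->
  (f y1 - f x1) * (y2 - x2) <=
    expR (dist_const p * ((v - u) / e)) * (f y2 - f x2) * (y1 - x1).
Proof.
move=> e0 er ev ux1 xy1 yv1 ux2 xy2 yv2.
have rn0 : r != 0 by rewrite lt0r_neq0.
have nle x y : x <= y -> nrm x <= nrm y.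
  by rewrite le_eqVlt => /predU1P[->//|/nrm_lt/ltW].
have : (bump p j (nrm y1) - bump p j (nrm x1)) * (nrm y2 - nrm x2) <=
    expR (dist_const p * ((nrm v - nrm u) / (e / r))) *
    (bump p j (nrm y2) - bump p j (nrm x2)) * (nrm y1 - nrm x1).
  apply: bump_distort => //; rewrite ?divr_gt0 ?nle ?nrm_lt//.
  - by rewrite ler_pdivrMr// mul1r.
  - by rewrite /nrm -mulNr !ler_pM2r ?invr_gt0.
have en0 : e != 0 by rewrite lt0r_neq0.
rewrite !nrmB !bendB (_ : (v - u) / r / (e / r) = (v - u) / e);
  last by field; rewrite ?rn0 ?en0.
move=> h.
have := ler_wpM2l (mulr_ge0 (ltW r0) (ltW r0)) h.
rewrite (_ : r * r * (_ * _) =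
  r * (bump p j (nrm y1) - bump p j (nrm x1)) * (y2 - x2)); last by field.
rewrite (_ : r * r * (expR _ * _ * _) = expR (dist_const p * ((v - u) / e)) *
  (r * (bump p j (nrm y2) - bump p j (nrm x2))) * (y1 - x1))//.
by field.
Qed.

Lemma bend_growth x y (e : R) : x < y -> 0 < e -> e <= r ->
  e <= `|x - z| -> f y - f x <= 2 * pmax p * (y - x) * r / e.
Proof.
move=> xy e0 er ez.
have : bump p j (nrm y) - bump p j (nrm x) <=
    2 * pmax p * (nrm y - nrm x) / (e / r).
  apply: bump_growth => //; rewrite ?divr_gt0//; first exact: nrm_lt.
    by rewrite ler_pdivrMr// mul1r.
  rewrite le_max; apply/orP; left.
  by rewrite /nrm normrM normfV (gtr0_norm r0) ler_pM2r ?invr_gt0.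
rewrite nrmB => /(ler_wpM2l (ltW r0)); rewrite -bendB; congr (_ <= _).
by field; rewrite !lt0r_neq0.
Qed.

Lemma bend_core c d : c <= z -> z <= d -> d - c = j * r ->
  let K := 3 `^ `|p - 1| in
  r * j `^ p <= K * (f d - f c) /\ f d - f c <= K * (r * j `^ p).
Proof.
move=> cz zd cd /=; have rV : 0 < r^-1 by rewrite invr_gt0.
have [||| h1 h2] := @bump_core _ p j p0 j01 (nrm c) (nrm d).
- by rewrite /nrm pmulr_lle0// subr_le0.
- by rewrite /nrm pmulr_lge0// subr_ge0.
- by rewrite nrmB cd mulfK// lt0r_neq0.
by rewrite bendB !(mulrCA _ r) !ler_pM2l.
Qed.

End Bend.

(** * Quasisymmetric distribution functions *)

Section PointwiseLimit.
Context {R : realType}.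

(* Convergence holds along an ultrafilter, so no estimate on the speed at which
   [f n] stabilizes is needed. *)
Lemma pointwise_cluster (f : nat -> R -> R) (M : R) :
  (forall n x, `|f n x - x| <= M) -> exists F : R -> R,
  [/\ forall x, `|F x - x| <= M,
      forall (q : R) x y u v, (forall n, f n y - f n x <= q * (f n v - f n u)) ->
        F y - F x <= q * (F v - F u) &
      forall x l N, (forall n, (N <= n)%N -> f n x = l) -> F x = l].
Proof.
move=> fM; have [U [UU oU]] := @ultraFilterLemma nat \oo _.
have cv x : exists l : R, f n x @[n --> U] --> l.
  have inI n : `[x - M, x + M]%classic (f n x).
    by rewrite /= in_itv /= -ler_distlC distrC.
  have [l [_ cl]] := @segment_compact R (x - M) (x + M) (f^~ x @ U) _
    (@filterE _ U _ _ inI).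
  exists l => V lV; have [//|UV] := in_ultra_setVsetC [set n | V (f n x)] UU.
  by have [y []] := cl (~` V) V UV lV.
have [F Fl] := choice cv.
exists F; split.
- move=> x; have cx : `|f n x - x| @[n --> U] --> `|F x - x|.
    by apply: cvg_norm; apply: cvgB => //; exact: cvg_cst.
  apply: (cvgr_to_le cx); exact: nearW.
- move=> q x y u v H.
  have c1 : f n y - f n x @[n --> U] --> F y - F x by apply: cvgB.
  have c2 : q * (f n v - f n u) @[n --> U] --> q * (F v - F u).
    by apply: cvgMr; apply: cvgB.
  by apply: (ler_cvg_to c1 c2); exact: nearW.
- move=> x l N H; have hl : f n x @[n --> U] --> l.
    apply: cvg_near_cst; apply: oU; exists N => // n; exact: H.
  exact: cvg_unique (Fl x) hl.
Qed.

End PointwiseLimit.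

Section Quasisymmetric.
Context {R : realType}.
Variables (F : R -> R) (Q : R).
Hypothesis ndF : {homo F : x y / x <= y}.
Hypothesis Q1 : 1 <= Q.
Hypothesis qsF : forall x r : R, 0 < r ->
  F x - F (x - r) <= Q * (F (x + r) - F x) /\
  F (x + r) - F x <= Q * (F x - F (x - r)).

(** Quasisymmetry at the centres [x - r] and [x + r] bounds each outer quarter by the adjacent inner
    one. This is the doubling inequality. *)
Lemma qs_expand x (r : R) : 0 < r ->
  F (x + 2 * r) - F (x - 2 * r) <= (1 + Q) * (F (x + r) - F (x - r)).
Proof.
move=> r0; have [_] := qsF (x + r) r0; have [+ _] := qsF (x - r) r0.
rewrite addrK subrK (_ : x + r + r = x + 2 * r); last by ring.
rewrite (_ : x - r - r = x - 2 * r); last by ring.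
by move=> h1 h2; lra.
Qed.

Lemma qs_shrink x (r : R) : 0 < r ->
  (1 + Q^-1) * (F (x + r) - F (x - r)) <= F (x + 2 * r) - F (x - 2 * r).
Proof.
move=> r0; have [+ _] := qsF (x + r) r0; have [_ +] := qsF (x - r) r0.
rewrite addrK subrK (_ : x + r + r = x + 2 * r); last by ring.
rewrite (_ : x - r - r = x - 2 * r); last by ring.
have Q0 : 0 < Q by have := Q1; lra.
rewrite -!ler_pdivrMl// => h1 h2; lra.
Qed.

Lemma qs_expand_iter N x (r : R) : 0 < r ->
  F (x + 2 ^+ N * r) - F (x - 2 ^+ N * r) <= (1 + Q) ^+ N * (F (x + r) - F (x - r)).
Proof.
move=> r0; elim: N => [|N IH]; first by rewrite !expr0 !mul1r.
have s0 : 0 < 2 ^+ N * r by rewrite mulr_gt0// exprn_gt0.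
rewrite !exprS -!(mulrA 2) (le_trans (qs_expand x s0))// -mulrA ler_wpM2l//.
by have := Q1; lra.
Qed.

(** Each halving of the radius divides the increment by at least [1 + Q^-1]; Bernoulli's inequality
    then makes it small. Hence the measure of [F] has no atoms. *)
Lemma qs_small x (e : R) : 0 < e -> exists2 r, 0 < r & F (x + r) - F (x - r) <= e.
Proof.
move=> e0; have Q0 : 0 < Q by have := Q1; lra.
have shr N : (1 + Q^-1) ^+ N * (F (x + 2 ^- N) - F (x - 2 ^- N)) <= F (x + 1) - F (x - 1).
  elim: N => [|N IH]; first by rewrite !expr0 mul1r invr1.
  apply: le_trans IH; rewrite exprSr -mulrA ler_wpM2l ?exprn_ge0 ?addr_ge0 ?invr_ge0 ?(ltW Q0)//.
  have h : 0 < 2 ^- N.+1 :> R by rewrite invr_gt0 exprn_gt0.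
  have := qs_shrink x h.
  by rewrite (_ : 2 * 2 ^- N.+1 = 2 ^- N)// exprS invfM mulrA divff ?mul1r.
set G := F (x + 1) - F (x - 1) in shr.
have G0 : 0 <= G by rewrite subr_ge0 ndF//; lra.
pose N := Num.bound (Q * G / e).
have Ng : Q * G / e < N%:R by rewrite archi_boundP// divr_ge0 ?mulr_ge0 ?(ltW Q0) ?(ltW e0).
exists (2 ^- N); first by rewrite invr_gt0 exprn_gt0.
set g := F _ - F _; have g0 : 0 <= g.
  rewrite subr_ge0 ndF// lerD2l; have : 0 <= 2 ^- N :> R by rewrite invr_ge0 exprn_ge0.
  lra.
have bern : 1 + N%:R * Q^-1 <= (1 + Q^-1) ^+ N.
  elim: (N) => [|n IH]; first by rewrite mul0r addr0 expr0.
  have q0 : 0 <= Q^-1 by rewrite invr_ge0 ltW.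
  rewrite exprSr; apply: (@le_trans _ _ ((1 + n%:R * Q^-1) * (1 + Q^-1))).
    rewrite -natr1; have : 0 <= n%:R * Q^-1 * Q^-1 :> R by rewrite !mulr_ge0.
    lra.
  by rewrite ler_wpM2r// addr_ge0.
rewrite leNgt; apply/negP => eg.
have := shr N; rewrite -/g leNgt => /negP; apply.
apply: (@lt_le_trans _ _ ((1 + N%:R * Q^-1) * e)); last first.
  by rewrite ler_pM ?addr_ge0 ?mulr_ge0 ?invr_ge0 ?(ltW Q0) ?(ltW e0)// ltW.
move: Ng; rewrite ltr_pdivrMr// -ltr_pdivlMl// => Ng.
by rewrite mulrDl mul1r; lra.
Qed.

(** [F] is within [M] of the identity, so its increment is positive at a large enough radius, and
    [qs_expand_iter] transfers this to radius [r]. *)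
Lemma qs_gt0 (M : R) x r : (forall y, `|F y - y| <= M) -> 0 < r -> F (x - r) < F (x + r).
Proof.
move=> FM r0; pose N := Num.bound (M / r).
have M0 : 0 <= M by exact: le_trans (normr_ge0 _) (FM 0).
have Ng : M < 2 ^+ N * r.
  rewrite -ltr_pdivrMr// (@lt_le_trans _ _ N%:R) ?archi_boundP ?divr_ge0 ?(ltW r0)//.
  by rewrite -natrX ler_nat ltnW// ltn_expl.
have := qs_expand_iter N x r0.
have := FM (x + 2 ^+ N * r); have := FM (x - 2 ^+ N * r).
rewrite !ler_norml => /andP[h1 h2] /andP[h3 h4] h5.
rewrite -subr_gt0 -(pmulr_rgt0 _ (_ : 0 < (1 + Q) ^+ N)); last first.
  by rewrite exprn_gt0//; have := Q1; lra.
lra.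
Qed.

End Quasisymmetric.

(** * Superposition of the profiles of all generations *)

Section Construction.
Context {R : realType} {T : Type}.
Implicit Types (x y u v : R) (n m : nat) (i k : T).
Variables (D : nat -> set T) (a b c d z : nat -> T -> R) (p kap : R).
Hypotheses (p0 : 0 < p) (kap0 : 0 < kap) (kap1 : kap <= 1 / 2).
Hypothesis center : forall n i, D n i ->
  a n i + kap * (b n i - a n i) <= z n i /\ z n i <= b n i - kap * (b n i - a n i).
Hypothesis hole : forall n i, D n i ->
  [/\ a n i <= c n i, c n i < z n i, z n i < d n i & d n i <= b n i].
Hypothesis disj : forall n i k, D n i -> D n k -> i <> k ->
  b n i <= a n k \/ b n k <= a n i.
Hypothesis nest : forall n m i, (n < m)%N -> D m i -> exists k,
  [/\ D n k, a n k <= a m i, b m i <= b n k & b m i <= c n k \/ d n k <= a m i].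

(** Small enough that windows are tiny compared with the depth [kap], even after multiplication by
    the growth constant [pmax p]. *)
Definition eta := kap / (1000 * pmax p).
Local Notation len n i := (b n i - a n i).
Definition rho n i := eta * len n i.
(** The cap at 1 handles holes longer than the window radius: for [j = 1] the profile is the
    identity. *)
Definition ratio n i := Num.min 1 ((d n i - c n i) / rho n i).

Lemma eta_bounds : [/\ 0 < eta, eta <= kap / 1000 & pmax p * eta = kap / 1000].
Proof.
have kap0' := kap0; have [m0 m1 mp P1 pP] := pminmax p0.
have P0 : 0 < pmax p by lra.
have M0 : 0 < 1000 * pmax p by lra.
rewrite /eta; split; first exact: divr_gt0.
  by apply: ler_wpM2l; [exact: ltW|rewrite lef_pV2 ?posrE; lra].
by rewrite invfM; field; exact: lt0r_neq0.
Qed.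

Lemma len_gt0 n i : D n i -> 0 < len n i.
Proof. by move=> /hole[]; lra. Qed.

Lemma rho_bounds n i : D n i -> 0 < rho n i /\ rho n i <= kap / 1000 * len n i.
Proof.
move=> Dn; have [e0 e1 _] := eta_bounds; have l0 := len_gt0 Dn.
by rewrite /rho mulr_gt0// ler_wpM2r// ltW.
Qed.

Lemma ratio_itv n i : D n i -> 0 < ratio n i <= 1.
Proof.
move=> Dn; have [r0 _] := rho_bounds Dn; have [h1 h2 h3 h4] := hole Dn.
rewrite /ratio lt_min ltr01 ge_min lexx/= andbT divr_gt0//.
lra.
Qed.

Definition twist n i := bend p (ratio n i) (z n i) (rho n i).

(** At most one index qualifies, since windows lie in the interiors of non-overlapping intervals;
    the choice is therefore immaterial. *)
Definition step n x :=
  match pselect (exists i, D n i /\ `|x - z n i| < rho n i) with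
  | left e => twist n (sval (cid e)) x
  | right _ => x
  end.

(* The finest generation acts first. *)
Fixpoint warp n x := if n is m.+1 then warp m (step m x) else x.

Lemma ball_in n i x : D n i -> `|x - z n i| <= kap / 2 * len n i ->
  a n i < x /\ x < b n i.
Proof.
move=> Dn; have l0 := len_gt0 Dn; have kap0' := kap0; have [c1 c2] := center Dn.
have kl : 0 < kap * len n i by rewrite mulr_gt0.
by rewrite ler_norml => /andP[h1 h2]; split; lra.
Qed.

Lemma rho_in n i x : D n i -> `|x - z n i| <= rho n i -> a n i < x /\ x < b n i.
Proof.
move=> Dn h; apply: ball_in => //; have [_ r1] := rho_bounds Dn.
have kl : 0 < kap * len n i by rewrite mulr_gt0// len_gt0.
lra.
Qed.

Lemma same_index n i k x : D n i -> D n k -> a n i < x -> x < b n i ->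
  a n k <= x -> x <= b n k -> i = k.
Proof.
move=> Di Dk h1 h2 h3 h4; apply: contrapT => ik.
have li := len_gt0 Di; have lk := len_gt0 Dk.
by have [] := disj Di Dk ik; lra.
Qed.

(** The formula holds on the whole interval and not only on its window, because [twist] is the
    identity in between. *)
Lemma stepE n i x : D n i -> a n i <= x -> x <= b n i -> step n x = twist n i x.
Proof.
move=> Di ax xb; rewrite /step; case: pselect => [e|ne].
  case: (cid e) => k /= [Dk /ltW /(rho_in Dk)[h1 h2]].
  by rewrite (same_index Dk Di h1 h2).
have [r0 _] := rho_bounds Di.
rewrite /twist bend_out// leNgt; apply/negP => h.
by apply: ne; exists i; split.
Qed.

Lemma step_out n x : (forall i, D n i -> rho n i <= `|x - z n i|) -> step n x = x.
Proof.
move=> h; rewrite /step; case: pselect => // e.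
by have [i [Di]] := e; rewrite ltNge h.
Qed.

Lemma step_cases n x : (exists i, [/\ D n i, `|x - z n i| < rho n i &
  step n x = twist n i x]) \/ step n x = x.
Proof.
have [[i [Di h]]|ne] := pselect (exists i, D n i /\ `|x - z n i| < rho n i).
  left; exists i; split => //; have [h1 h2] := rho_in Di (ltW h).
  by apply: stepE; rewrite // ltW.
right; apply: step_out => i Di; rewrite leNgt; apply/negP => h.
by apply: ne; exists i; split.
Qed.

Lemma twist_lt n i x y : D n i -> x < y -> twist n i x < twist n i y.
Proof. by move=> Di; apply: bend_lt; rewrite ?ratio_itv//; case: (rho_bounds Di). Qed.

Lemma twist_ball n i x : D n i -> `|x - z n i| <= rho n i ->
  `|twist n i x - z n i| <= rho n i.
Proof.
by move=> Di; apply: bend_ball; rewrite ?ratio_itv//; case: (rho_bounds Di).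
Qed.

Lemma twist_out n i x : D n i -> rho n i <= `|x - z n i| -> twist n i x = x.
Proof. by move=> Di; apply: bend_out; case: (rho_bounds Di). Qed.

(** Within one interval this is the monotonicity of [twist]. Across intervals, each window is mapped
    into itself, so the order of the intervals decides. *)
Lemma step_lt n x y : x < y -> step n x < step n y.
Proof.
move=> xy.
have [[i [Di hi xi]]|xE] := step_cases n x; last first.
  rewrite xE; have [[k [Dk hk yk]]|->//] := step_cases n y.
  have [ax|xa] := leP (a n k) x.
    have [h1 h2] := rho_in Dk (ltW hk).
    by rewrite yk -xE (stepE Dk)//; [exact: twist_lt|lra].
  rewrite yk; have [h1 h2] := rho_in Dk (twist_ball Dk (ltW hk)); lra.
have [h1 h2] := rho_in Di (ltW hi).
have [yb|by_] := leP y (b n i).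
  by rewrite xi (stepE Di _ yb); [exact: twist_lt|lra].
have [g1 g2] := rho_in Di (twist_ball Di (ltW hi)).
have [[k [Dk hk yk]]|->] := step_cases n y; last by rewrite xi; lra.
have [e1 e2] := rho_in Dk (ltW hk).
have ik : i <> k by move=> ik; move: e2; rewrite -ik; lra.
have [f1 f2] := rho_in Dk (twist_ball Dk (ltW hk)).
have li := len_gt0 Di; have lk := len_gt0 Dk.
by rewrite xi yk; have [] := disj Di Dk ik; lra.
Qed.

Lemma warp_lt n x y : x < y -> warp n x < warp n y.
Proof. by elim: n x y => [//|n IH] x y xy /=; apply/IH/step_lt. Qed.

Lemma warp_le n x y : x <= y -> warp n x <= warp n y.
Proof. by rewrite le_eqVlt => /predU1P[->//|/(warp_lt n)/ltW]. Qed.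

(* [z n k] lies in a hole that later intervals avoid, whereas [z m i] is deep
   inside its own interval. *)
Lemma nested n m k i x : (n < m)%N -> D n k -> D m i ->
  `|x - z n k| <= rho n k -> a m i < x -> x < b m i ->
  [/\ a n k <= a m i, b m i <= b n k & kap * len m i <= `|z n k - z m i|].
Proof.
move=> nm Dk Di xk ax xb; have [k' [Dk' ak bk ck]] := nest nm Di.
have [h1 h2] := rho_in Dk xk.
have {Dk' ak bk ck} [ak bk ck] : [/\ a n k <= a m i, b m i <= b n k &
    b m i <= c n k \/ d n k <= a m i].
  by rewrite (same_index Dk Dk' h1 h2)//; lra.
split => //; have [g1 g2 g3 g4] := hole Dk; have [c1 c2] := center Di.
have kl : 0 < kap * len m i by rewrite mulr_gt0// len_gt0.
case: ck => ck; last by rewrite ler0_norm; lra.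
by rewrite ger0_norm; lra.
Qed.

(** * Bounded distortion of the compositions *)

Definition slack := 2 * dist_const p / kap.

Lemma slack_ge0 : 0 <= slack.
Proof.
have [m0 _ _ _ _] := pminmax p0.
have ? := ltW m0; have ? := ltW kap0.
by rewrite /slack /dist_const !mulr_ge0 ?addr_ge0 ?mulr_ge0 ?invr_ge0.
Qed.

(** Every point of [[u, v]] is within [kap / 4 * len m i] of [z m i], which by [nested] is at least
    [kap * len m i] away from [z n k]. So [[u, v]] misses [z n k] and stays on one side of it, and
    [e <= rho n k] because [[u, v]] meets the coarser window. *)
Lemma anchor_far n m k i u v : (n < m)%N -> D n k -> D m i ->
  (exists w, [/\ u <= w, w <= v & `|w - z m i| <= rho m i]) ->
  (exists w, [/\ u <= w, w <= v & `|w - z n k| < rho n k]) ->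
  v - u <= kap / 8 * len m i ->
  let e := kap / 2 * len m i in
  [/\ forall x, u <= x -> x <= v -> a n k < x /\ x < b n k,
      e <= `|u - z n k|, e <= rho n k &
      e <= u - z n k \/ v - z n k <= - e].
Proof.
move=> nm Dk Di [w [uw wv hw]] [w' [uw' wv' hw']] uv e.
have l0 := len_gt0 Di; have [rm0 rm] := rho_bounds Di.
have kl : 0 < kap * len m i by rewrite mulr_gt0.
have inI x : u <= x -> x <= v -> `|x - z m i| <= kap / 4 * len m i.
  move: hw; rewrite !ler_norml => /andP[h1 h2] ux xv.
  by apply/andP; split; lra.
have inI' x : u <= x -> x <= v -> a m i < x /\ x < b m i.
  move=> ux xv; apply: ball_in => //; apply: le_trans (inI x ux xv) _.
  by rewrite ler_wpM2r ?(ltW l0)// ler_wpM2l ?(ltW kap0)// lef_pV2 ?posrE ?ltr0n//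
    ler_nat.
have [ak bk sep] : [/\ a n k <= a m i, b m i <= b n k &
    kap * len m i <= `|z n k - z m i|].
  have [h1 h2] := inI' _ uw' wv'.
  exact: (nested nm Dk Di (ltW hw') h1 h2).
have e0 : 0 < e by rewrite /e mulr_gt0// divr_gt0.
have far x : u <= x -> x <= v -> e <= `|x - z n k|.
  move=> ux xv; have := inI x ux xv; have := ler_distD x (z n k) (z m i).
  rewrite (distrC (z n k) x) /e; move: sep kl.
  move: (`|z n k - z m i|) (`|x - z n k|) (`|x - z m i|) => A B C.
  move: (len m i) => l; lra.
split.
- by move=> x ux xv; have [h1 h2] := inI' x ux xv; split;
    [exact: le_lt_trans h1|exact: lt_le_trans bk].
- by apply: far => //; exact: le_trans wv.
- by rewrite (le_trans (far w' uw' wv'))// ltW.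
have uv' : u <= v by exact: le_trans wv.
have [zu|uz] := leP (z n k) u.
  by left; have := far u (lexx _) uv'; rewrite ger0_norm// subr_ge0.
have [vz|zv] := leP v (z n k).
  by right; have := far v uv' (lexx _); rewrite ler0_norm ?subr_le0// lerNr.
by have := far _ (ltW uz) (ltW zv); rewrite subrr normr0 leNgt e0.
Qed.

(* [(m, i)] is the last interval whose window was met; at each new relevant
   window the relative size [t] is at least halved, and
   [slack * t + 2 * slack * (t / 2) = 2 * slack * t]. *)
Lemma warp_distort n m i u v (t : R) : (n <= m)%N -> D m i ->
  (exists w, [/\ u <= w, w <= v & `|w - z m i| <= rho m i]) ->
  v - u <= t * len m i -> 0 <= t -> t <= kap / 8 ->
  forall x1 y1 x2 y2, u <= x1 -> x1 < y1 -> y1 <= v ->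
    u <= x2 -> x2 < y2 -> y2 <= v ->
  (warp n y1 - warp n x1) * (y2 - x2) <=
    expR (2 * slack * t) * (warp n y2 - warp n x2) * (y1 - x1).
Proof.
elim: n m i u v t => [|n IH] m i u v t nm Di [w [uw wv hw]] uv t0 tk
  x1 y1 x2 y2 ux1 xy1 yv1 ux2 xy2 yv2.
  rewrite /= -mulrA (mulrC (y1 - x1)) ler_peMl ?mulr_ge0 ?subr_ge0 ?(ltW xy1)
    ?(ltW xy2)//.
  by rewrite -expR0 ler_expR mulr_ge0// mulr_ge0// slack_ge0.
have [[k [w' [Dk uw' wv' hw']]]|no] :=
    pselect (exists k w', [/\ D n k, u <= w', w' <= v & `|w' - z n k| < rho n k]);
    last first.
  have sid x : u <= x -> x <= v -> step n x = x.
    move=> ux xv; apply: step_out => k Dk; rewrite leNgt; apply/negP => h.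
    by apply: no; exists k, x.
  rewrite /= !sid//; first last;
    try by [exact: le_trans (ltW xy1) yv1|exact: le_trans (ltW xy2) yv2|
      exact: le_trans ux1 (ltW xy1)|exact: le_trans ux2 (ltW xy2)].
  by apply: (IH m i u v t (ltnW nm) Di) => //; exists w.
have l0 := len_gt0 Di; have [rk0 _] := rho_bounds Dk; have lk0 := len_gt0 Dk.
have [_ _ Peta] := eta_bounds.
have uv0 : u < v by apply: (le_lt_trans ux1); exact: lt_le_trans yv1.
set e := kap / 2 * len m i.
have e0 : 0 < e by rewrite /e mulr_gt0// divr_gt0.
have [inI ue er side] : [/\ forall x, u <= x -> x <= v -> a n k < x /\ x < b n k,
      e <= `|u - z n k|, e <= rho n k & e <= u - z n k \/ v - z n k <= - e].
  apply: (anchor_far nm Dk Di); [by exists w|by exists w'|].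
  by rewrite (le_trans uv)// ler_wpM2r// ltW.
have sE x : u <= x -> x <= v -> step n x = twist n k x.
  by move=> ux xv; have [h1 h2] := inI x ux xv; apply: stepE => //; exact: ltW.
(* [bend_growth] together with [pmax p * eta = kap / 1000] gives the factor [t / 250], which is more
   than enough. *)
have gr : twist n k v - twist n k u <= t / 2 * len n k.
  apply: (le_trans (bend_growth p0 (ratio_itv Dk) rk0 uv0 e0 er ue)).
  rewrite ler_pdivrMr// (_ : t / 2 * len n k * e = kap / 4 * (t * len m i) * len n k);
    last by rewrite /e; field.
  rewrite (_ : 2 * pmax p * (v - u) * rho n k = 2 * (pmax p * eta) * (v - u) * len n k);
    last by rewrite /rho; ring.
  rewrite ler_wpM2r ?(ltW lk0)// Peta; have kap0' := kap0.
  apply: (ler_pM _ _ _ uv); last by lra.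
    by lra.
  by rewrite subr_ge0 ltW.
have th : 0 <= t / 2 by rewrite divr_ge0.
have {IH} := IH n k (twist n k u) (twist n k v) (t / 2) (leqnn _) Dk _ gr th _
  (twist n k x1) (twist n k y1) (twist n k x2) (twist n k y2).
have tle x y : x <= y -> twist n k x <= twist n k y.
  by rewrite le_eqVlt => /predU1P[->//|/(twist_lt Dk)/ltW].
have wex : exists w0, [/\ twist n k u <= w0, w0 <= twist n k v &
    `|w0 - z n k| <= rho n k].
  by exists (twist n k w'); rewrite !tle// twist_ball// ltW.
have t8 : t / 2 <= kap / 8 by move: t0 tk; lra.
move=> /(_ wex t8); rewrite !tle ?twist_lt// => /(_ isT isT isT isT isT isT) IH.
rewrite /= !sE//; try by [exact: le_trans (ltW xy1) yv1|exact: le_trans (ltW xy2) yv2|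
  exact: le_trans ux1 (ltW xy1)|exact: le_trans ux2 (ltW xy2)].
have := bend_distort p0 (ratio_itv Dk) rk0 e0 er side ux1 xy1 yv1 ux2 xy2 yv2.
rewrite -/(twist n k _) => bd.
have B1 := twist_lt Dk xy1; have B2 := twist_lt Dk xy2.
have A2 := warp_lt n B2.
have bd' : (twist n k y1 - twist n k x1) * (y2 - x2) <=
    expR (slack * t) * (twist n k y2 - twist n k x2) * (y1 - x1).
  apply: (le_trans bd); rewrite !ler_wpM2r ?subr_ge0 ?(ltW xy1) ?(ltW B2)//.
  (* Here [(v - u) / e <= t * len m i / e = 2 * t / kap], which explains the value of [slack]. *)
  rewrite ler_expR /slack (_ : 2 * dist_const p / kap * t =
    dist_const p * (t * len m i / e)); last first.
    by rewrite /e; field; rewrite !lt0r_neq0.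
  have dc : 0 <= dist_const p.
    have [m0 _ _ _ _] := pminmax p0; have ? := ltW m0.
    by rewrite /dist_const addr_ge0 ?mulr_ge0 ?invr_ge0.
  by rewrite ler_wpM2l// ler_wpM2r// invr_ge0 ltW.
(* The claim is multiplied by the intermediate increment, which cancels when the bounds for [warp n]
   and for [twist] are chained. *)
rewrite -(ler_pM2l (_ : 0 < twist n k y2 - twist n k x2)) ?subr_gt0//.
rewrite (_ : 2 * slack * t = slack * t + 2 * slack * (t / 2)); last by field.
rewrite expRD mulrA (mulrC (twist n k y2 - _)).
apply: (le_trans (ler_wpM2r _ IH)); first by rewrite subr_ge0 ltW.
rewrite -[leLHS]mulrA.
apply: (le_trans (ler_wpM2l _ bd')).
  by rewrite mulr_ge0 ?subr_ge0 ?(ltW A2)// ltW// expR_gt0.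
by rewrite le_eqVlt; apply/orP; left; apply/eqP; ring.
Qed.

(* Invariant of a point moved only by windows of intervals shorter than [s]: the
   last window dominates the total displacement. *)
Definition tracked (s : R) x0 n x := x = x0 \/ exists m i,
  [/\ (n <= m)%N, D m i, len m i < s, `|x - z m i| <= rho m i &
      `|x - x0| <= 4 * eta * len m i].

(** By [nested], [kap * len m i] is at most the sum of the two radii, so the new interval is at
    least twice as long as the old one. The old displacement is then at most [2 * eta * len n k],
    and the new move adds at most as much. *)
Lemma tracked_step (s : R) x0 n x : tracked s x0 n.+1 x ->
  (forall k, D n k -> `|x - z n k| < rho n k -> len n k < s) ->
  tracked s x0 n (step n x).
Proof.
move=> nx small; have [[k [Dk hk ->]]|->] := step_cases n x; last first.
  case: nx => [->|[m [i [nm Di ls h1 h2]]]]; first by left.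
  by right; exists m, i; split => //; exact: ltnW.
right; exists n, k; split => //; first exact: small.
  by apply: twist_ball => //; exact: ltW.
have [rk0 rk] := rho_bounds Dk; have lk0 := len_gt0 Dk.
have mv : `|twist n k x - x| <= 2 * rho n k.
  exact: (bend_close (z n k) p0 (ratio_itv Dk) rk0).
have tri := ler_distD x (twist n k x) x0.
have [e0 _ _] := eta_bounds.
have el : 0 < eta * len n k by rewrite mulr_gt0.
have goal (q : R) : `|x - x0| <= q -> q <= 2 * (eta * len n k) ->
    `|twist n k x - x0| <= 4 * eta * len n k.
  by move=> q1 q2; rewrite /rho in mv; lra.
case: nx => [xx|[m [i [nm Di ls h1 h2]]]].
  by apply: (goal 0); [rewrite xx subrr normr0|lra].
have [a1 b1] := rho_in Di h1.
have [_ _ sep] := nested nm Dk Di (ltW hk) a1 b1.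
have [_ ri] := rho_bounds Di; have li := len_gt0 Di.
have half : kap * len m i <= kap * (len n k / 2).
  have := ler_distD x (z n k) (z m i); rewrite (distrC (z n k) x).
  have : 0 < kap * len n k by rewrite mulr_gt0.
  by have : 0 < kap * len m i; [rewrite mulr_gt0|lra].
apply: (goal _ h2); rewrite ler_pM2l// in half.
by rewrite (_ : 2 * (eta * len n k) = 4 * eta * (len n k / 2));
  [rewrite ler_wpM2l// mulr_ge0// ltW|field].
Qed.

Lemma tracked_dist (s : R) x0 n x : 0 < s -> tracked s x0 n x ->
  `|x - x0| <= 4 * eta * s.
Proof.
have [e0 _ _] := eta_bounds; have e4 : 0 <= 4 * eta by rewrite mulr_ge0// ltW.
move=> s0 [->|[m [i [_ _ ls _ h]]]]; first by rewrite subrr normr0 mulr_ge0// ltW.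
by rewrite (le_trans h)// ler_wpM2l// ltW.
Qed.

Lemma warp_displacement (s : R) n x : 0 < s ->
  (forall m i, D m i -> len m i < s) -> `|warp n x - x| <= 4 * eta * s.
Proof.
move=> s0 ls; suff H y : tracked s x n y -> `|warp n y - x| <= 4 * eta * s.
  by apply: H; left.
elim: n y => [|n IH] y; first exact: tracked_dist.
by move=> ny; apply/IH/tracked_step => // k Dk _; exact: ls.
Qed.

(** * Uniform quasisymmetry of the compositions *)

Lemma twist_widen n k u v : D n k -> v - u <= kap / 16 * len n k ->
  twist n k v - twist n k u <= kap / 8 * len n k.
Proof.
move=> Dk vu; have [r0 rk] := rho_bounds Dk.
have := bend_close (z n k) p0 (ratio_itv Dk) r0 u.
have := bend_close (z n k) p0 (ratio_itv Dk) r0 v.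
rewrite -!/(twist n k _) !ler_norml => /andP[h1 h2] /andP[h3 h4].
have kl : 0 < kap * len n k by rewrite mulr_gt0// len_gt0.
move: (twist n k v) (twist n k u) h1 h2 h3 h4 => s t h1 h2 h3 h4.
by lra.
Qed.

(** The first factor pays for the first long window met, the second for the distortion of all
    subsequent maps. *)
Definition qs_bound := qs_const p * expR (2 * slack * (kap / 8)).

Lemma qs_bound_ge3 : 3 <= qs_bound.
Proof.
have [m0 m1 mp P1 pP] := pminmax p0.
have E1 : 1 <= expR (2 * slack * (kap / 8)).
  rewrite -expR0 ler_expR; apply: mulr_ge0; last by rewrite divr_ge0// ltW.
  by rewrite mulr_ge0// slack_ge0.
have S1 : 1 <= 7 `^ `|p - 1| :> R.
  by rewrite -[leLHS](powRr0 7); apply: ler_powR => //; rewrite ler1n.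
have Pm : 1 <= 4 * pmax p / pmin p by rewrite ler_pdivlMr//; lra.
have h1 : 1 * 3 <= 4 * pmax p / pmin p * 3 by rewrite ler_wpM2r.
have h2 : 3 * 1 <= qs_const p by rewrite /qs_const ler_pM//; lra.
by rewrite /qs_bound -[leLHS](mulr1 3) ler_pM//; lra.
Qed.

(** While only windows of intervals shorter than [s] are met, the three points keep their
    proportions. The first window of a longer interval is controlled by [bend_qs], and everything
    after it by [warp_distort]. *)
Lemma warp_qs n x (r : R) : 0 < r ->
  warp n x - warp n (x - r) <= qs_bound * (warp n (x + r) - warp n x) /\
  warp n (x + r) - warp n x <= qs_bound * (warp n x - warp n (x - r)).
Proof.
(* The 48 serves two bounds: [4 * eta * s <= r / 4], and [3 * r = kap / 16 * s], so that the triple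
   is short compared with any interval of length at least [s]. *)
move=> r0; pose s := 48 / kap * r.
have s0 : 0 < s by rewrite /s mulr_gt0// divr_gt0.
suff H u y v : tracked s (x - r) n u -> tracked s x n y -> tracked s (x + r) n v ->
    warp n y - warp n u <= qs_bound * (warp n v - warp n y) /\
    warp n v - warp n y <= qs_bound * (warp n y - warp n u).
  by apply: H; left.
have [e0 e1 _] := eta_bounds.
have es : 4 * eta * s <= r / 4.
  have h : 4 * eta * s <= 4 * (kap / 1000) * s.
    by rewrite ler_wpM2r ?(ltW s0)// ler_wpM2l.
  apply: (le_trans h).
  rewrite (_ : _ * s = 192 / 1000 * r); last by rewrite /s; field; rewrite lt0r_neq0.
  by rewrite mulrC ler_wpM2l ?(ltW r0)//; lra.
have ks : kap * s = 48 * r by rewrite /s; field; rewrite lt0r_neq0.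
have Q3 := qs_bound_ge3.
(* Displacements of at most [r / 4] leave both gaps between [r / 2] and [3 * r / 2], hence the ratio
   3. *)
have geo n' u' y' v' : tracked s (x - r) n' u' -> tracked s x n' y' -> tracked s (x + r) n' v' ->
    [/\ u' < y', y' < v', y' - u' <= 3 * (v' - y'), v' - y' <= 3 * (y' - u') &
      v' - u' <= 3 * r].
  move=> /(tracked_dist s0) hu /(tracked_dist s0) hy /(tracked_dist s0) hv.
  have {hu hy hv} : [/\ `|u' - (x - r)| <= r / 4, `|y' - x| <= r / 4 &
      `|v' - (x + r)| <= r / 4] by split; exact: le_trans es.
  rewrite !ler_norml => -[/andP[h1 h2] /andP[h3 h4] /andP[h5 h6]].
  by move: h1 h2 h3 h4 h5 h6 r0; split; lra.
elim: n u y v => [|n IH] u y v nu ny nv;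
    have [uy yv yu vy vu] := geo _ _ _ _ nu ny nv.
  rewrite /=; split.
    by apply: (le_trans yu); rewrite ler_wpM2r// subr_ge0 ltW.
  by apply: (le_trans vy); rewrite ler_wpM2r// subr_ge0 ltW.
have [[k [w [Dk sk uw wv hw]]]|no] := pselect (exists k w,
    [/\ D n k, s <= len n k, u <= w, w <= v & `|w - z n k| < rho n k]); last first.
  have small t : u <= t -> t <= v ->
      forall k, D n k -> `|t - z n k| < rho n k -> len n k < s.
    move=> ut tv k Dk h; rewrite ltNge; apply/negP => sk.
    by apply: no; exists k, t.
  have uv := lt_trans uy yv.
  apply: IH; apply: tracked_step => //; apply: small => //; exact: ltW.
have [rk0 rk] := rho_bounds Dk; have lk0 := len_gt0 Dk.
have vu' : v - u <= kap / 16 * len n k.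
  apply: (le_trans vu).
  rewrite (_ : 3 * r = kap / 16 * s); first by rewrite ler_wpM2l// divr_ge0// ltW.
  by rewrite mulrAC ks; field.
(* The whole triple lies in the long interval, so a single [twist] acts on it. *)
have sE t : u <= t -> t <= v -> step n t = twist n k t.
  move=> ut tv.
  have [|h1 h2] := @ball_in n k t Dk.
    have : `|t - w| <= v - u by rewrite ler_norml; lra.
    have := ler_distD w t (z n k).
    have : 0 < kap * len n k by rewrite mulr_gt0.
    lra.
  by apply: stepE; rewrite // ltW.
have [q1 q2] : twist n k y - twist n k u <= qs_const p * (twist n k v - twist n k y) /\
    twist n k v - twist n k y <= qs_const p * (twist n k y - twist n k u).
  by apply: bend_qs => //; exact: ratio_itv.
have wide := twist_widen Dk vu'.
have uy' := twist_lt Dk uy; have yv' := twist_lt Dk yv.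
have tle t1 t2 : t1 <= t2 -> twist n k t1 <= twist n k t2.
  by rewrite le_eqVlt => /predU1P[->//|/(twist_lt Dk)/ltW].
have wex : exists w0, [/\ twist n k u <= w0, w0 <= twist n k v &
    `|w0 - z n k| <= rho n k].
  by exists (twist n k w); rewrite !tle// twist_ball// ltW.
have cd := warp_distort (leqnn n) Dk wex wide (divr_ge0 (ltW kap0) (ler0n _ _)) (lexx _).
rewrite /= !sE ?(ltW uy) ?(ltW yv) ?(ltW (lt_trans uy yv))//.
set E := expR _ in cd *.
have c1 := cd _ _ _ _ (lexx _) uy' (ltW yv') (ltW uy') yv' (lexx _).
have c2 := cd _ _ _ _ (ltW uy') yv' (lexx _) (lexx _) uy' (ltW yv').
have cu := warp_lt n uy'; have cv := warp_lt n yv'.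
rewrite /qs_bound -/E.
have fin (A B A' B' : R) : 0 < A' -> 0 < B' -> 0 <= B ->
    A * B' <= E * B * A' -> A' <= qs_const p * B' -> A <= qs_const p * E * B.
  move=> A0 B0 B0' h1 h2; rewrite -(ler_pM2r B0); apply: (le_trans h1).
  rewrite (_ : qs_const p * E * B * B' = E * B * (qs_const p * B')); last by ring.
  by rewrite ler_wpM2l// mulr_ge0// expR_ge0.
split.
  by apply: (fin _ _ _ _ _ _ _ c1 q1); rewrite ?subr_gt0// subr_ge0 ltW.
by apply: (fin _ _ _ _ _ _ _ c2 q2); rewrite ?subr_gt0// subr_ge0 ltW.
Qed.

(** A window of a later generation lies in the interior of an interval on one side of the hole, so
    it contains no endpoint of an earlier interval or hole. *)
Lemma warp_fix n m i x : (n < m)%N -> D n i ->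
  [\/ x = a n i, x = b n i, x = c n i | x = d n i] -> warp m x = warp n.+1 x.
Proof.
move=> + Di hx; have [g1 g2 g3 g4] := hole Di.
have ax : a n i <= x by case: hx => ->; lra.
have xb : x <= b n i by case: hx => ->; lra.
have fix_step m' : (n < m')%N -> step m' x = x.
  move=> nm; apply: step_out => k Dk; rewrite leNgt; apply/negP => /ltW h.
  have [h1 h2] := rho_in Dk h; have [i' [Di' ai bi ci]] := nest nm Dk.
  have ii : i' = i.
    by apply: (same_index Di' Di _ _ ax xb);
      [exact: le_lt_trans h1|exact: lt_le_trans bi].
  rewrite {}ii in ai bi ci.
  by case: hx => xE; rewrite xE in h1 h2; case: ci; lra.
elim: m => // m IH; rewrite ltnS leq_eqVlt => /predU1P[->//|nm].
by rewrite /= fix_step// IH.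
Qed.

(** * Mass of a hole relative to its interval *)

Definition mass_bound (N : nat) :=
  2 * expR (2 * slack * (kap / 8)) * 3 `^ `|p - 1| * (1 + qs_bound) ^+ N / eta `^ p.

(** Doubling the radius [rho n i / 2] of the ball [N] times makes it at least [len n i], so the ball
    covers the interval from any centre in it. *)
Lemma mass_ball (N : nat) n i x : 2 <= 2 ^+ N * eta -> D n i ->
  a n i <= x -> x <= b n i -> forall m,
  warp m (b n i) - warp m (a n i) <= (1 + qs_bound) ^+ N *
    (warp m (x + rho n i / 2) - warp m (x - rho n i / 2)).
Proof.
move=> N2 Di ax xb m; have [r0 _] := rho_bounds Di; have l0 := len_gt0 Di.
have r2 : 0 < rho n i / 2 by rewrite divr_gt0.
have qs : forall x r : R, 0 < r ->
  warp m x - warp m (x - r) <= qs_bound * (warp m (x + r) - warp m x) /\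
  warp m (x + r) - warp m x <= qs_bound * (warp m x - warp m (x - r)).
  by move=> *; exact: warp_qs.
have Q1 : 1 <= qs_bound by apply: le_trans qs_bound_ge3; rewrite ler1n.
apply: le_trans (qs_expand_iter Q1 qs N x r2).
have big : len n i <= 2 ^+ N * (rho n i / 2).
  rewrite /rho (_ : _ * _ = (2 ^+ N * eta) * (len n i / 2)); last by field.
  apply: (@le_trans _ _ (2 * (len n i / 2))); first by lra.
  by rewrite ler_wpM2r// divr_ge0// ltW.
by rewrite lerB// warp_le//; lra.
Qed.

Let window n i (s : R) : D n i -> `|s| = rho n i ->
  [/\ a n i < z n i + s, z n i + s < b n i & twist n i (z n i + s) = z n i + s].
Proof.
move=> Di hs; have E : `|z n i + s - z n i| = rho n i by rewrite addrC addKr.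
have [h1 h2] : a n i < z n i + s /\ z n i + s < b n i by apply: rho_in; rewrite ?E.
by split => //; rewrite twist_out// E.
Qed.

(** [bend_core] compares the twisted hole with the window, and [warp n] has bounded distortion on
    that window. The factors 2 come from the window length [2 * rho n i]. *)
Lemma hole_window n i : D n i -> d n i - c n i < rho n i ->
  let F := warp n.+1 in
  let J := F (d n i) - F (c n i) in
  let W := F (z n i + rho n i) - F (z n i - rho n i) in
  let E := expR (2 * slack * (kap / 8)) in
  let K := 3 `^ `|p - 1| in
  [/\ 2 * J <= E * K * ratio n i `^ p * W & ratio n i `^ p * W <= 2 * E * K * J].
Proof.
move=> Di small; have [g1 g2 g3 g4] := hole Di.
have [r0 rk] := rho_bounds Di.
have cd : c n i < d n i by exact: lt_trans g3.
have uv : z n i - rho n i < z n i + rho n i by lra.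
have vu : z n i + rho n i - (z n i - rho n i) = 2 * rho n i by ring.
have uc : z n i - rho n i <= c n i by lra.
have dv : d n i <= z n i + rho n i by lra.
have wide : z n i + rho n i - (z n i - rho n i) <= kap / 8 * len n i.
  have : 0 < kap * len n i by rewrite mulr_gt0// len_gt0.
  by rewrite vu; lra.
have wex : exists w, [/\ z n i - rho n i <= w, w <= z n i + rho n i &
    `|w - z n i| <= rho n i].
  exists (z n i); rewrite subrr normr0 lerDl lerBlDr lerDl.
  by split; exact: ltW.
move=> F J W E K.
have Nr : `|rho n i| = rho n i by rewrite gtr0_norm.
have Nr' : `|(- rho n i)| = rho n i by rewrite normrN.
have [_ vb vE] := window Di Nr; have [au _ uE] := window Di Nr'.
have ad := le_trans g1 (ltW cd); have cb := le_trans (ltW cd) g4.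
have av := ltW (lt_trans au uv); have ub := ltW (lt_trans uv vb).
have jE : ratio n i = (d n i - c n i) / rho n i.
  by rewrite /ratio min_r// ler_pdivrMr// mul1r ltW.
have [b1 b2] : rho n i * ratio n i `^ p <=
      K * (twist n i (d n i) - twist n i (c n i)) /\
    twist n i (d n i) - twist n i (c n i) <= K * (rho n i * ratio n i `^ p).
  apply: bend_core; rewrite ?(ltW g2) ?(ltW g3) ?ratio_itv//.
  by rewrite jE divfK// lt0r_neq0.
have FE x : a n i <= x -> x <= b n i -> F x = warp n (twist n i x).
  by move=> ax xb; rewrite /F /= (stepE Di).
have tle x y : x <= y -> twist n i x <= twist n i y.
  by rewrite le_eqVlt => /predU1P[->//|/(twist_lt Di)/ltW].
have cu : z n i - rho n i <= twist n i (c n i) by rewrite -uE tle.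
have dv' : twist n i (d n i) <= z n i + rho n i by rewrite -vE tle.
have cd' := twist_lt Di cd.
have cds := warp_distort (leqnn n) Di wex wide (divr_ge0 (ltW kap0) (ler0n _ _)) (lexx _).
have c1 := cds _ _ _ _ cu cd' dv' (lexx _) uv (lexx _).
have c2 := cds _ _ _ _ (lexx _) uv (lexx _) cu cd' dv'.
have WE : W = warp n (z n i + rho n i) - warp n (z n i - rho n i).
  by rewrite /W !FE ?uE ?vE// ltW.
have JE : J = warp n (twist n i (d n i)) - warp n (twist n i (c n i)).
  by rewrite /J !FE.
rewrite -/E -JE -WE vu in c1 c2.
have W0 : 0 <= W by rewrite subr_ge0 warp_le// ltW.
have E0 : 0 <= E by rewrite expR_ge0.
have K0 : 0 <= K by rewrite powR_ge0.
split; rewrite -(ler_pM2r r0).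
  rewrite (_ : 2 * J * rho n i = J * (2 * rho n i)); last by ring.
  apply: (le_trans c1).
  rewrite (_ : E * K * ratio n i `^ p * W * rho n i =
    E * W * (K * (rho n i * ratio n i `^ p))); last by ring.
  by rewrite ler_wpM2l// mulr_ge0.
rewrite (_ : ratio n i `^ p * W * rho n i = W * (rho n i * ratio n i `^ p)); last by ring.
apply: (le_trans (ler_wpM2l W0 b1)); rewrite mulrCA.
rewrite (_ : 2 * E * K * J * rho n i = K * (E * J * (2 * rho n i))); last by ring.
by rewrite ler_wpM2l.
Qed.

(** A hole at least as long as [rho n i] carries a fixed proportion of the mass, and [h] lies
    between [eta] to the power [p] and 1. A shorter hole is compared with the window by
    [hole_window], and the window with the interval by [mass_ball]; dividing by [len n i] instead of
    [rho n i] costs the power of [eta] in [mass_bound]. *)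
Lemma hole_mass (N : nat) n i : 2 <= 2 ^+ N * eta -> D n i ->
  let F := warp n.+1 in
  let h := ((d n i - c n i) / len n i) `^ p in
  F (d n i) - F (c n i) <= mass_bound N * (h * (F (b n i) - F (a n i))) /\
  h * (F (b n i) - F (a n i)) <= mass_bound N * (F (d n i) - F (c n i)).
Proof.
move=> N2 Di F h; have [g1 g2 g3 g4] := hole Di.
have [r0 _] := rho_bounds Di; have l0 := len_gt0 Di; have [e0 e1 _] := eta_bounds.
have dc0 : 0 <= d n i - c n i by lra.
have ball := fun x ax xb => mass_ball N2 Di ax xb n.+1 (x := x).
rewrite /mass_bound; set E := expR _; set K := 3 `^ _; set B := (1 + qs_bound) ^+ N in ball *.
have E1 : 1 <= E.
  rewrite -expR0 ler_expR; apply: mulr_ge0; last by rewrite divr_ge0// ltW.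
  by rewrite mulr_ge0// slack_ge0.
have K1 : 1 <= K by rewrite -[leLHS](powRr0 3); apply: ler_powR; rewrite ?ler1n.
have B1 : 1 <= B by rewrite exprn_ege1//; have := qs_bound_ge3; lra.
have oneP : 1 `^ p = 1 :> R by rewrite powR1.
set q := eta `^ p; have q0 : 0 < q by rewrite powR_gt0.
have q1 : q <= 1.
  rewrite -[leRHS]oneP ge0_ler_powR ?nnegrE ?(ltW p0) ?(ltW e0)//.
  by have := kap1; lra.
have qn0 : q != 0 by rewrite lt0r_neq0.
have E0 : 0 <= E := le_trans ler01 E1.
have K0 : 0 <= K := le_trans ler01 K1.
have B0 : 0 <= B := le_trans ler01 B1.
have EK1 : 1 <= E * K by rewrite -[leLHS](mulr1 1) ler_pM.
have EK2 : 1 <= 2 * E * K by rewrite -mulrA -[leLHS](mulr1 1) ler_pM// ler1n.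
have EKB : 1 <= 2 * E * K * B by rewrite -[leLHS](mulr1 1) ler_pM.
have Fle x y : x <= y -> F x <= F y by exact: warp_le.
have G0 : 0 <= F (b n i) - F (a n i) by rewrite subr_ge0 Fle// -subr_ge0 ltW.
have cd : c n i <= d n i by rewrite -subr_ge0.
have J0 : 0 <= F (d n i) - F (c n i) by rewrite subr_ge0 Fle.
have JG : F (d n i) - F (c n i) <= F (b n i) - F (a n i) by rewrite lerB// Fle.
have [big|small] := leP (rho n i) (d n i - c n i).
  have h0 : 0 <= (d n i - c n i) / len n i by rewrite divr_ge0// ltW.
  have hq : q <= h.
    rewrite ge0_ler_powR ?nnegrE ?(ltW p0) ?(ltW e0)//.
    by rewrite ler_pdivlMr.
  have h1 : h <= 1.
    rewrite -[leRHS]oneP ge0_ler_powR ?nnegrE ?(ltW p0)//.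
    by rewrite ler_pdivrMr// mul1r lerB.
  (* The ball of radius [rho n i / 2] about the midpoint of the hole stays inside the hole. *)
  have mid : F (b n i) - F (a n i) <= B * (F (d n i) - F (c n i)).
    apply: (le_trans (ball ((c n i + d n i) / 2) _ _)); [lra|lra|].
    by rewrite ler_wpM2l// lerB ?Fle//; lra.
  move: JG G0 J0 mid; rewrite -!/F; set G := F (b n i) - _; set J := F (d n i) - _.
  move=> JG G0 J0 mid; split.
    rewrite (le_trans JG)// (_ : _ * (h * G) = (2 * E * K * B) * (h / q) * G);
      last by field.
    by rewrite ler_peMl// -[leLHS](mulr1 1) ler_pM// ler_pdivlMr// mul1r.
  rewrite (@le_trans _ _ (1 * G)) ?ler_wpM2r// mul1r (le_trans mid)//.
  rewrite (_ : 2 * E * K * B / q * J = (2 * E * K / q) * (B * J)); last by ring.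
  by rewrite ler_peMl ?mulr_ge0// ler_pdivlMr// mul1r (le_trans q1).
have [up lo] := hole_window Di small.
have Nr : `|rho n i| = rho n i by rewrite gtr0_norm.
have Nr' : `|(- rho n i)| = rho n i by rewrite normrN.
have [_ vb _] := window Di Nr; have [au _ _] := window Di Nr'.
have zi : a n i <= z n i /\ z n i <= b n i by split; lra.
have GW := ball _ zi.1 zi.2.
rewrite -!/F -/E -/K in up lo GW.
have WG : F (z n i + rho n i) - F (z n i - rho n i) <= F (b n i) - F (a n i).
  by rewrite lerB ?Fle// ltW.
have W0 : 0 <= F (z n i + rho n i) - F (z n i - rho n i).
  by rewrite subr_ge0 Fle//; lra.
have {}GW : F (b n i) - F (a n i) <= B * (F (z n i + rho n i) - F (z n i - rho n i)).
  by rewrite (le_trans GW)// ler_wpM2l// lerB ?Fle//; lra.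
have hE : h = q * ratio n i `^ p.
  rewrite /h /q -powRM ?(ltW e0)//; last by case/andP: (ratio_itv Di) => /ltW.
  congr (_ `^ _); rewrite /ratio min_r; last by rewrite ler_pdivrMr// mul1r ltW.
  by rewrite /rho; field; rewrite !lt0r_neq0.
rewrite hE; set y := ratio n i `^ p in up lo *.
have y0 : 0 <= y by rewrite powR_ge0.
move: up lo WG W0 GW J0 G0; set G := F (b n i) - _; set J := F (d n i) - _.
set W := F (_ + _) - _ => up lo WG W0 GW J0 G0.
have S0 : 0 <= E * K * y * G by rewrite !mulr_ge0.
split.
  rewrite (_ : _ * (_ * G) = 2 * B * (E * K * y * G)); last by field.
  rewrite (@le_trans _ _ (2 * J))// ?ler_peMl ?ler1n//.
  apply: (le_trans up); apply: (@le_trans _ _ (E * K * y * G)).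
    by rewrite ler_wpM2l// !mulr_ge0.
  by rewrite ler_peMl// -[leLHS](mulr1 1) ler_pM// ler1n.
rewrite -mulrA (@le_trans _ _ (1 * (y * G))) ?ler_wpM2r ?mulr_ge0// mul1r.
rewrite (@le_trans _ _ (B * (y * W)))//; first by rewrite mulrCA ler_wpM2l.
rewrite (@le_trans _ _ (B * (2 * E * K * J)))// ?ler_wpM2l//.
rewrite (_ : 2 * E * K * B / q * J = (B * (2 * E * K * J)) / q); last by ring.
by rewrite ler_pdivlMr// ler_piMr// !mulr_ge0.
Qed.

End Construction.

(** * From distribution functions to Borel regular outer measures *)

Section Stieltjes.
Context {R : realType}.
Variable F : R -> R.
Hypothesis ndF : {homo F : x y / x <= y}.
Hypothesis ctF : forall x (e : R), 0 < e ->
  exists2 r, 0 < r & F (x + r) - F (x - r) <= e.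

Let rcF : right_continuous F.
Proof.
move=> x; apply/cvgrPdist_le => e e0; have [r r0 hr] := ctF x e0.
near=> y; rewrite ler0_norm ?subr_le0; last first.
  by apply: ndF; near: y; exact: nbhs_right_ge.
rewrite opprB; apply: le_trans hr; apply: lerB; apply: ndF; last by rewrite gerBl ltW.
by near: y; apply: nbhs_right_le; rewrite ltrDl.
Unshelve. all: by end_near. Qed.

(** The outer measure is generated by half-open intervals. Continuity of [F] lets a closed interval
    be enlarged and an open one shrunk to a half-open one at arbitrarily small cost. *)
Lemma stieltjes_outer_measure : exists mu : {outer_measure set R -> \bar R},
  borel_regular_outer_measure mu /\
  forall a b, a <= b -> mu [set` `[a, b]] = (F b - F a)%:E /\
    mu [set` `]a, b[] = (F b - F a)%:E.
Proof.
pose f : cumulative R R := HB.pack F (isCumulative.Build R _ R F ndF rcF).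
pose mu : {outer_measure set R -> \bar R} :=
  [the {outer_measure set (ocitv_type R) -> \bar R} of (wlength f)^*%mu].
have ocE a b : a <= b -> mu [set` `]a, b]] = (F b - F a)%:E.
  move=> ab; transitivity (wlength f `]a, b]%classic); last exact: wlength_itv_bnd.
  by apply: measurable_mu_extE; exact: is_ocitv.
have small x (e : R) : 0 < e -> exists r, [/\ 0 < r, F x - F (x - r) <= e &
    F (x + r) - F x <= e].
  move=> e0; have [r r0 hr] := ctF x e0; exists r; split => //.
    by apply: le_trans hr; rewrite lerB// ndF// lerDl ltW.
  by apply: le_trans hr; rewrite lerB// ndF// gerBl ltW.
exists mu; split; last first.
  move=> a b ab; have ooc : (mu [set` `]a, b[] <= mu [set` `]a, b]])%E.
    by apply: le_outer_measure; exact: subset_itvW.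
  have occ : (mu [set` `]a, b]] <= mu [set` `[a, b]])%E.
    by apply: le_outer_measure; exact: subset_itv_oc_cc.
  split; apply/eqP; rewrite eq_le; apply/andP; split.
  - apply/lee_addgt0Pr => e e0; have [r [r0 hr _]] := small a e e0.
    have arb : a - r <= b by rewrite (le_trans _ ab)// gerBl ltW.
    apply: (@le_trans _ _ (mu [set` `]a - r, b]])).
      apply: le_outer_measure => x /=; rewrite !in_itv/= => /andP[ax ->].
      by rewrite andbT (lt_le_trans _ ax)// gtrBl.
    by rewrite ocE// -EFinD lee_fin; lra.
  - by rewrite -ocE.
  - by rewrite -ocE.
  - apply/lee_addgt0Pr => e e0; have [r [r0 hr _]] := small b e e0.
    have [abr|bra] := leP a (b - r); last first.
      have : (F b - F a <= e)%R.
        by apply: le_trans hr; rewrite lerB// ndF// ltW.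
      by rewrite -lee_fin => /le_trans; apply; rewrite leeDr// outer_measure_ge0.
    set y := b - r in abr hr *.
    apply: (@le_trans _ _ (mu [set` `]a, y]] + e%:E)%E).
      by rewrite ocE// -EFinD lee_fin; lra.
    rewrite leeD2r// le_outer_measure// => x /=; rewrite !in_itv/= => /andP[-> xb].
    by rewrite (le_lt_trans xb)// /y gtrBl.
have ocB X : (@measurable _ (ocitv_type R)) X -> borel_set X.
  move=> [[x y] _ <-] /=.
  (* A half-open interval is Borel as a difference of two open rays. *)
  have -> : `]x, y]%classic = `]x, +oo[%classic `\` `]y, +oo[%classic.
    apply/seteqP; split => t /=; rewrite !in_itv/= !andbT.
      by move=> /andP[-> ty]; split => //; apply/negP; rewrite -leNgt.
    by move=> [-> /negP]; rewrite -leNgt.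
  apply: (@measurableD _ (g_sigma_algebraType (@open R))); apply: sub_sigma_algebra.
    exact: interval_open.
  exact: interval_open.
split.
  move=> B bB; apply: (@sub_caratheodory _ (ocitv_type R) R (wlength f)).
  move: B bB; apply: smallest_sub; first exact: sigma_algebra_measurable.
  move=> A oA; exact: open_measurable.
move=> A; have [Aoo|Afin] := eqVneq (mu A) +oo%E.
  exists setT; split => //; first exact: (@measurableT _ (g_sigma_algebraType (@open R))).
  by apply/eqP; rewrite Aoo -leye_eq -Aoo le_outer_measure.
have {}Afin : mu A \is a fin_num.
  by rewrite ge0_fin_numE ?outer_measure_ge0// ltey.
(* The Borel hull is the intersection of countable half-open covers with excess [1 / (n + 1)]. *)
have cov n : exists C : (set (ocitv_type R))^nat, measurable_cover (A : set (ocitv_type R)) C /\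
    (mu (\bigcup_k C k) <= mu A + n.+1%:R^-1%:E)%E.
  have n0 : 0 < n.+1%:R^-1 :> R by rewrite invr_gt0.
  have [_ [C CA <-] hC] := lb_ereal_inf_adherent n0 Afin.
  have {}hC : (\sum_(k <oo) wlength f (C k) < mu A + n.+1%:R^-1%:E)%E := hC.
  exists C; split; first exact: CA.
  apply: (le_trans _ (ltW hC)).
  apply: (le_trans (outer_measure_sigma_subadditive mu C)).
  rewrite (@eq_eseriesr _ (mu \o C) (wlength f \o C))// => k _.
  by apply: measurable_mu_extE; case: CA.
have [C hC] := choice cov.
exists (\bigcap_n \bigcup_k C n k); split.
- apply: (@bigcapT_measurable _ (g_sigma_algebraType (@open R))) => n.
  apply: bigcupT_measurable => k.
  by apply: ocB; case: (hC n) => -[+ _] _; exact.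
- by apply: sub_bigcap => n _; case: (hC n) => -[].
apply/eqP; rewrite eq_le; apply/andP; split; last first.
  by apply: le_outer_measure; apply: sub_bigcap => n _; case: (hC n) => -[].
apply/lee_addgt0Pr => e e0.
near \oo => n.
apply: (@le_trans _ _ (mu A + n.+1%:R^-1%:E)%E).
  by apply: le_trans (hC n).2; apply: le_outer_measure; exact: bigcap_inf.
rewrite leeD2l// lee_fin ltW//; near: n; exact: near_infty_natSinv_lt (PosNum e0).
Unshelve. all: by end_near. Qed.

End Stieltjes.

(** * Cantor constructions *)

Section CantorData.
Context {R : realType} {T : Type}.
Variables (D : nat -> set T) (a b c d : nat -> T -> R).
Hypothesis cons : cantor_construction D a b c d.

(** The point [z] shows that the hole is nonempty. If an endpoint of the hole stuck out of the
    interval, the midpoint between it and the nearby endpoint of the interval would be in the hole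
    only. *)
Lemma cantor_hole n i z : D n i -> c n i < z -> z < d n i ->
  a n i <= c n i /\ d n i <= b n i.
Proof.
move=> Di cz zd; have [_ [_ [sub _]]] := cons.
have inI t : c n i < t -> t < d n i -> a n i <= t /\ t <= b n i.
  move=> ct td; have /andP[] : t \in `[a n i, b n i] by apply: sub; rewrite //= in_itv/= ct.
  by [].
have [az zb] := inI z cz zd.
split; rewrite leNgt; apply/negP => h.
  have [] := inI ((c n i + a n i) / 2); lra.
by have [] := inI ((d n i + b n i) / 2); lra.
Qed.

Lemma cantor_disjoint n i k : D n i -> D n k -> i <> k ->
  a n i < b n i -> a n k < b n k -> b n i <= a n k \/ b n k <= a n i.
Proof.
move=> Di Dk ik abi abk; have [_ [disj _]] := cons.
have [h|h1] := leP (b n i) (a n k); first by left.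
have [h|h2] := leP (b n k) (a n i); first by right.
exfalso; have := disj n i k Di Dk ik; apply/eqP/set0P.
pose u := Num.max (a n i) (a n k); pose v := Num.min (b n i) (b n k).
have uv : u < v by rewrite gt_max !lt_min abi h1 h2 abk.
exists ((u + v) / 2).
have u1 : a n i <= u by rewrite le_max lexx.
have u2 : a n k <= u by rewrite le_max lexx orbT.
have v1 : v <= b n i by rewrite ge_min lexx.
have v2 : v <= b n k by rewrite ge_min lexx orbT.
by split; rewrite /= in_itv/=; apply/andP; split; lra.
Qed.

(** The union of the next generation omits every hole, so a child, being connected, lies on one side
    of its parent's hole. Later descendants inherit this. *)
Lemma cantor_nest n m i : (n < m)%N ->
  (forall n i, D n i -> c n i < d n i) -> D m i -> exists k,
  [/\ D n k, a n k <= a m i, b m i <= b n k & b m i <= c n k \/ d n k <= a m i].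
Proof.
move=> + cd; have [ab [_ [_ [par [eqU _]]]]] := cons.
have step m' i' : D m'.+1 i' -> exists k, [/\ D m' k, a m' k <= a m'.+1 i',
    b m'.+1 i' <= b m' k & b m'.+1 i' <= c m' k \/ d m' k <= a m'.+1 i'].
  move=> Di; have [k Dk sub] := par _ _ Di; have abi := ab _ _ Di.
  have /andP[ak _] : a m'.+1 i' \in `[a m' k, b m' k].
    by apply: sub; rewrite /= in_itv/= lexx.
  have /andP[_ bk] : b m'.+1 i' \in `[a m' k, b m' k].
    by apply: sub; rewrite /= in_itv/= lexx abi.
  exists k; split => //.
  have [h|h1] := leP (b m'.+1 i') (c m' k); first by left.
  have [h|h2] := leP (d m' k) (a m'.+1 i'); first by right.
  have avoid t : a m'.+1 i' <= t -> t <= b m'.+1 i' -> ~ (c m' k < t /\ t < d m' k).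
    move=> at_ tb [ct td].
    have : (\bigcup_(i in D m'.+1) [set` `[a m'.+1 i, b m'.+1 i]]) t.
      by exists i' => //=; rewrite in_itv/= at_.
    rewrite eqU => -[_]; apply; exists k => //=; by rewrite in_itv/= ct.
  have cdk := cd _ _ Dk.
  have [ca|ac] := leP (a m'.+1 i') (c m' k).
    pose v := Num.min (b m'.+1 i') (d m' k).
    have cv : c m' k < v by rewrite lt_min h1.
    have v1 : v <= b m'.+1 i' by rewrite ge_min lexx.
    have v2 : v <= d m' k by rewrite ge_min lexx orbT.
    by exfalso; apply: (avoid ((c m' k + v) / 2)); [lra|lra|split; lra].
  by exfalso; apply: (avoid (a m'.+1 i')); rewrite ?lexx.
elim: m i => // m IH i; rewrite ltnS leq_eqVlt => /predU1P[<-|nm] Di.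
  exact: step.
have [k [Dk ak bk _]] := step _ _ Di.
have [k' [Dk' ak' bk' ck']] := IH k nm Dk.
exists k'; split => //; [exact: le_trans ak|exact: le_trans bk'|].
by case: ck' => ck'; [left; exact: le_trans ck'|right; exact: le_trans ak].
Qed.

End CantorData.


Unset Implicit Arguments.

Theorem theorem1p2 (R : realType) (T : Type) (D : nat -> set T)
    (a b c d : nat -> T -> R) :
  cantor_construction D a b c d -> nice D a b c d ->
  forall p : R, 0 < p ->
  exists (mu : {outer_measure set R -> \bar R}) (lam Lam : R),
    [/\ doubling mu, 0 < lam, lam <= Lam &
      forall n i, D n i ->
        lam * ((d n i - c n i) / (b n i - a n i)) `^ p
          <= fine (mu [set` `]c n i, d n i[]) / fine (mu [set` `[a n i, b n i]])
        /\ fine (mu [set` `]c n i, d n i[]) / fine (mu [set` `[a n i, b n i]])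
          <= Lam * ((d n i - c n i) / (b n i - a n i)) `^ p].
Proof.
move=> cons [k [k0 k1 niceJ]] p p0.
have [Z hZ] : exists Z : nat * T -> R, forall q, D q.1 q.2 ->
    concentric k (a q.1 q.2) (b q.1 q.2) (Z q) /\ c q.1 q.2 < Z q /\ Z q < d q.1 q.2.
  suff /choice[Z hZ] : forall q : nat * T, exists x, D q.1 q.2 ->
      concentric k (a q.1 q.2) (b q.1 q.2) x /\ c q.1 q.2 < x /\ x < d q.1 q.2.
    by exists Z.
  (* The value 0 is a placeholder for indices outside [D n]. *)
  move=> [n i] /=; have [Di|nDi] := pselect (D n i); last by exists 0.
  have [x [cx]] := niceJ n i Di; rewrite /= in_itv/= => /andP[h1 h2].
  by exists x.
(* A point of the concentric interval of factor [k] is at relative distance at least [(1 - k) / 2]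
   from both ends. *)
pose z n i := Z (n, i); pose kap := (1 - k) / 2.
have kap0 : 0 < kap by rewrite /kap; lra.
have kap1 : kap <= 1 / 2 by rewrite /kap; lra.
have hole n i : D n i -> [/\ a n i <= c n i, c n i < z n i, z n i < d n i & d n i <= b n i].
  move=> Di; have [_ [cz zd]] := hZ (n, i) Di.
  by have [ac db] := cantor_hole cons Di cz zd.
have center n i : D n i -> a n i + kap * (b n i - a n i) <= z n i /\
    z n i <= b n i - kap * (b n i - a n i).
  move=> Di; have [+ _] := hZ (n, i) Di; rewrite /concentric /= in_itv/= -/(z n i).
  by move=> /andP[h1 h2]; rewrite /kap; split; lra.
have cd n i : D n i -> c n i < d n i by move=> /hole[_ /lt_trans cz /cz].
have ab n i : D n i -> a n i < b n i.
  by move=> Di; have [ac cz zd db] := hole n i Di; lra.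
have disj n i i' : D n i -> D n i' -> i <> i' -> b n i <= a n i' \/ b n i' <= a n i.
  by move=> Di Di' ii; apply: (cantor_disjoint cons) => //; exact: ab.
have nest n m i : (n < m)%N -> D m i -> exists i', [/\ D n i', a n i' <= a m i,
    b m i <= b n i' & b m i <= c n i' \/ d n i' <= a m i].
  by move=> nm Di; exact: (cantor_nest cons).
have [s s0 hs] : exists2 s, 0 < s & forall m i, D m i -> b m i - a m i < s.
  have [_ [_ [_ [_ [_ [_ [M hM]]]]]]] := cons.
  have len0 i : D 0%N i -> b 0%N i - a 0%N i <= 2 * `|M|.
    move=> Di; have abi := ab _ _ Di; have MM := ler_norm M.
    have ha : `|a 0%N i| <= M by apply: (hM i) => //; rewrite /= in_itv/= lexx ltW.
    have hb : `|b 0%N i| <= M by apply: (hM i) => //; rewrite /= in_itv/= lexx ltW.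
    by move: ha hb; rewrite !ler_norml; lra.
  (* [M] may be negative when generation 0 is empty, hence the absolute value; adding 1 makes the
     bound positive and strict. *)
  have MM := normr_ge0 M; exists (2 * `|M| + 1); first by lra.
  move=> [|m] i Di; first by have := len0 i Di; lra.
  have [i' [Di' h1 h2 _]] := nest 0%N m.+1 i isT Di.
  by have := len0 i' Di'; lra.
pose f := warp D a b c d z p kap.
have f_disp n x : `|f n x - x| <= 4 * eta p kap * s.
  exact: (warp_displacement p0 kap0 center hole disj nest).
have f_le n x y : x <= y -> f n x <= f n y.
  exact: (warp_le p0 kap0 center hole disj).
have [F [F_disp F_le F_cst]] := pointwise_cluster f_disp.
have ndF : {homo F : x y / x <= y}.
  (* Monotonicity passes to the limit as the inequality with multiplier 0. *)
  move=> x y xy; have := F_le 0 y x 0 0; rewrite mul0r subr_le0; apply=> n.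
  by rewrite mul0r subr_le0 f_le.
pose Q := qs_bound p kap.
have Q3 : 3 <= Q by exact: qs_bound_ge3.
have Q1 : 1 <= Q by lra.
have qsF x r : 0 < r -> F x - F (x - r) <= Q * (F (x + r) - F x) /\
    F (x + r) - F x <= Q * (F x - F (x - r)).
  move=> r0; split; apply: F_le => n;
    by have [] := warp_qs p0 kap0 center hole disj nest n x r0.
have F_fix n i x : D n i -> [\/ x = a n i, x = b n i, x = c n i | x = d n i] ->
    F x = f n.+1 x.
  move=> Di hx; apply: (F_cst _ _ n.+1) => m nm.
  exact: (warp_fix p0 kap0 center hole disj nest nm Di hx).
have [mu [mu_reg mu_itv]] := stieltjes_outer_measure ndF (qs_small ndF Q1 qsF).
have [N hN] : exists N : nat, 2 <= 2 ^+ N * eta p kap.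
  have [e0 _ _] := eta_bounds p0 kap0.
  exists (Num.bound (2 / eta p kap)); rewrite -ler_pdivrMr//.
  have n0 : 0 <= 2 / eta p kap by rewrite divr_ge0// ltW.
  apply: le_trans (ltW (archi_boundP n0)) _.
  by rewrite -natrX ler_nat ltnW// ltn_expl.
(* The maximum with 1 ensures that [L^-1 <= L]. *)
pose L := Num.max 1 (mass_bound p kap N).
have L1 : 1 <= L by rewrite le_max lexx.
have Lm : mass_bound p kap N <= L by rewrite le_max lexx orbT.
have L0 : 0 < L by lra.
exists mu, L^-1, L; split.
- split => //; exists (1 + Q) => x r r0.
  have muB t : 0 < t -> mu (ball x t) = (F (x + t) - F (x - t))%:E.
    move=> t0; rewrite ball_itv; have xt : x - t <= x + t by lra.
    by have [_ ->] := mu_itv _ _ xt.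
  have r2 : 0 < 2 * r by lra.
  rewrite !muB//; split; last exact: ltry.
    by rewrite lte_fin subr_gt0 (qs_gt0 Q1 qsF x F_disp).
  by rewrite -EFinM lee_fin qs_expand.
- by rewrite invr_gt0.
- by apply: (le_trans _ L1); rewrite invf_le1.
move=> n i Di; have [ac cz zd db] := hole n i Di.
have [/ltW cdi abi] := (cd n i Di, ab n i Di).
have [_ ->] := mu_itv _ _ cdi; have [-> _] := mu_itv _ _ (ltW abi).
(* All four endpoints are frozen from stage [n.+1] on, so the ratio is computed for the finite
   composition. *)
rewrite /= (F_fix n i (a n i)) ?(F_fix n i (b n i)) ?(F_fix n i (c n i))
  ?(F_fix n i (d n i))//; try by [constructor|constructor 2|constructor 3|constructor 4].
have [up lo] := hole_mass p0 kap0 kap1 center hole disj nest hN Di.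
rewrite -/f in up lo; set h := (_ / _) `^ p in up lo *.
have G0 : 0 < f n.+1 (b n i) - f n.+1 (a n i).
  by rewrite subr_gt0; apply: (warp_lt p0 kap0 center hole disj).
have J0 : 0 <= f n.+1 (d n i) - f n.+1 (c n i) by rewrite subr_ge0 f_le.
have h0 : 0 <= h by rewrite powR_ge0.
split.
  rewrite ler_pdivlMr// -mulrA ler_pdivrMl//; apply: (le_trans lo).
  by rewrite ler_wpM2r.
rewrite ler_pdivrMr// -mulrA; apply: (le_trans up).
by rewrite ler_wpM2r// mulr_ge0// ltW.
Qed.
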